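(* Consider the nonautonomous control system described in the context. All controlled $(\varepsilon,T)$-chains below are understood to have jump times $T_i\in[T,2T]$ (so the jump times of a controlled $(\varepsilon,3T)$-chain lie in $[3T,6T]$). Fix $\omega_0\in\Omega$ and suppose that there is a nonvoid set $F_{\omega_0}\subset M$ with the property that for all $x_0,y_0\in F_{\omega_0}$ and all $\varepsilon,T>0$ there exists a controlled $(\varepsilon,T)$-chain from $(\omega_0,x_0)$ to $(\omega_0,y_0)$. Let $F$ be the set of all $(\omega,z)\in\Omega\times M$ such that there exist $x_0,y_0\in F_{\omega_0}$ with the following property: for all $\varepsilon,T>0$ there exist a controlled $(\varepsilon,3T)$-chain from $(\omega_0,x_0)$ to $(\omega_0,y_0)$ (with points $(\omega_j,x_j)$, controls $u_j$ and $n$ segments), an index $i\in\{0,\dots,n-1\}$ and a time $\tau\in[T,2T]$ such that $\omega=\omega_i\cdot\tau$ and $d(z,\varphi(\tau,\omega_i,x_i,u_i))<\varepsilon$. Then $F$ is chain controllable. Moreover, $F$ is contained in a chain control set if $F$ is contained in a maximal chain controllable set in $\Omega\times Q$ with $Q\subset M$ compact.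
   Context: Setting. $M$ is a connected $d$-dimensional $C^\infty$-manifold with tangent bundle $TM$; $\Omega$ is a compact metric space with a minimal continuous flow $\sigma:\mathbb{R}\times\Omega\to\Omega$, written $\sigma(t,\omega)=\sigma_t(\omega)=\omega\cdot t$. The maps $f_0,\dots,f_m:\Omega\times M\to TM$ are continuous and every $f_i(\omega,\cdot)$ is a $C^1$ vector field on $M$. $U\subset\mathbb{R}^m$ is compact and convex and $\mathcal{U}=\{u\in L^\infty(\mathbb{R},\mathbb{R}^m): u(t)\in U \text{ for almost all } t\in\mathbb{R}\}$. The control system is $\dot x(t)=f_0(\omega\cdot t,x(t))+\sum_{i=1}^m u_i(t)f_i(\omega\cdot t,x(t))$, $u\in\mathcal{U}$. For all $(\omega,x_0,u)\in\Omega\times M\times\mathcal{U}$ there is a unique (Carathéodory) solution $\varphi(t,\omega,x_0,u)$ with $\varphi(0,\omega,x_0,u)=x_0$, assumed to exist for all $t\in\mathbb{R}$. Put $\psi(t,\omega,x,u)=(\omega\cdot t,\varphi(t,\omega,x,u))$. The letter $d$ denotes the metric on $\Omega$ and a fixed metric on $M$ compatible with its topology. Controlled chains. For $\varepsilon,T>0$, a controlled $(\varepsilon,T)$-chain from $(\omega,x)$ to $(\overline\omega,y)$ in $\Omega\times M$ is given by $n\in\mathbb{N}$ ($n\ge1$), points $(\omega_0,x_0)=(\omega,x),(\omega_1,x_1),\dots,(\omega_n,x_n)=(\omega_n,y)\in\Omega\times M$, controls $u_0,\dots,u_{n-1}\in\mathcal{U}$ and times $T_0,\dots,T_{n-1}\ge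 T$ such that (i) $\omega_j\cdot T_j=\omega_{j+1}$ for $j=0,\dots,n-1$ and $d(\omega_n,\overline\omega)<\varepsilon$; (ii) $d(\varphi(T_j,\omega_j,x_j,u_j),x_{j+1})<\varepsilon$ for $j=0,\dots,n-1$. A nonvoid set $A\subset\Omega\times M$ is chain controllable if for all $(\omega,x),(\overline\omega,y)\in A$ and all $\varepsilon,T>0$ there is a controlled $(\varepsilon,T)$-chain from $(\omega,x)$ to $(\overline\omega,y)$. If, for all $\varepsilon,T>0$, these chains can be taken with all segments $\varphi(t,\omega_j,x_j,u_j)$, $t\in[0,T_j]$, contained in $Q\subset M$, then $A$ is called chain controllable in $\Omega\times Q$. A maximal chain controllable set is a chain controllable set that is maximal with respect to inclusion among chain controllable subsets of $\Omega\times M$; a maximal chain controllable set in $\Omega\times Q$ is a maximal chain controllable set that is chain controllable in $\Omega\times Q$ (in particular contained in $\Omega\times Q$). A chain control set is a nonvoid set $E\subset\Omega\times M$, maximal (with respect to inclusion) with the properties: (i) for all $(\omega,x)\in E$ there is $u\in\mathcal{U}$ with $\psi(t,\omega,x,u)\in E$ for all $t\in\mathbb{R}$; (ii) for all $(\omega,x),(\overline\omega,y)\in E$ and all $\varepsilon,T>0$ there is a controlled $(\varepsilon,T)$-chain from $(\omega,x)$ to $(\overline\omega,y)$.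
   Formalization: The claim that F is chain controllable is stated for nonvoid F only: because ω = ω_i·τ is required exactly, F is empty whenever ω_0 is not a periodic point of the flow, and chain controllable sets are nonvoid by definition. *)

(* Defs.v *)
From HB Require Import structures.
From mathcomp Require Import all_boot all_order all_algebra.
From mathcomp Require Import all_classical all_reals all_analysis.

Set Implicit Arguments.
Unset Strict Implicit.
Unset Printing Implicit Defensive.

Import Order.TTheory GRing.Theory Num.Theory.
Import numFieldNormedType.Exports.

Local Open Scope classical_set_scope.
Local Open Scope ring_scope.

(** * Smooth manifolds through atlases *)

(* f is of class C^k on the (open) set A; only the germ of f along A matters. *)
Fixpoint class_C (R : realType) (d e k : nat) (A : set 'rV[R]_d)
    (f : 'rV[R]_d -> 'rV[R]_e) : Prop :=
  match k with
  | 0%N => forall x, A x -> {for x, continuous f}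
  | k'.+1 => (forall x, A x -> differentiable f x) /\
             forall v : 'rV[R]_d, class_C k' A (fun x => 'd f x v)
  end.

(* A homeomorphism from an open subset of M onto an open subset of R^d, given
   by total functions whose values off these sets are irrelevant. *)
Record chart (R : realType) (M : topologicalType) (d : nat) := Chart {
  cdom : set M;
  cmap : M -> 'rV[R]_d;
  cinv : 'rV[R]_d -> M;
  cdom_open : open cdom;
  cimg_open : open (cmap @` cdom);
  cmapK : forall p, cdom p -> cinv (cmap p) = p;
  cmap_continuous : forall p, cdom p -> {for p, continuous cmap};
  cinv_continuous : forall y, (cmap @` cdom) y -> {for y, continuous cinv} }.

Definition smooth_atlas (R : realType) (M : topologicalType) (d : nat)
    (A : set (chart R M d)) : Prop :=
  (forall p : M, exists2 c, A c & cdom c p) /\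
  (forall c c', A c -> A c' -> forall k,
     class_C k (cmap c @` (cdom c `&` cdom c')) (cmap c' \o cinv c)).

(* A tangent vector at p is the family of its coordinate columns in the charts
   around p, any two of which are related by the differential of the change of
   charts; v c is irrelevant when p is not in the domain of c. *)
Definition tangent_vector (R : realType) (M : topologicalType) (d : nat)
    (A : set (chart R M d)) (p : M) (v : chart R M d -> 'rV[R]_d) : Prop :=
  forall c c', A c -> A c' -> cdom c p -> cdom c' p ->
    v c' = 'd (cmap c' \o cinv c) (cmap c p) (v c).

Definition C1_vector_field (R : realType) (M : topologicalType) (d : nat)
    (A : set (chart R M d)) (X : M -> chart R M d -> 'rV[R]_d) : Prop :=
  (forall p, tangent_vector A p (X p)) /\
  (forall c, A c -> class_C 1 (cmap c @` cdom c) (fun y => X (cinv c y) c)).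

(* Continuity of Omega * M -> TM, (w, p) |-> f w p in T_pM, read in the local
   trivializations of TM given by the charts. *)
Definition continuous_to_TM (R : realType) (Omega M : topologicalType)
    (d : nat) (A : set (chart R M d))
    (f : Omega -> M -> chart R M d -> 'rV[R]_d) : Prop :=
  forall c, A c -> forall (w : Omega) (p : M), cdom c p ->
    {for (w, p), continuous (fun q : Omega * M => f q.1 q.2 c)}.

(** * Minimal flows *)

Definition minimal_flow (R : realType) (Omega : topologicalType)
    (sigma : R -> Omega -> Omega) : Prop :=
  [/\ continuous (fun q : R * Omega => sigma q.1 q.2),
      forall w, sigma 0 w = w,
      forall s t w, sigma (s + t) w = sigma s (sigma t w) &
      forall K : set Omega, closed K -> K !=set0 ->
        (forall t w, K w -> K (sigma t w)) -> K = [set: Omega]].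

(** * Nonautonomous control-affine systems *)

(* Controls are represented by functions rather than by classes modulo null
   sets; two a.e. equal controls have the same solutions. *)
Definition admissible (R : realType) (m : nat) (U : set 'rV[R]_m)
    (u : R -> 'rV[R]_m) : Prop :=
  (forall i, (fun t => u t ord0 i) \in Lfun (@lebesgue_measure R) +oo%E) /\
  {ae (@lebesgue_measure R), forall t, U (u t)}.

(* Coordinates in the chart c of f_0(w.t, p) + sum_i (u t)_i f_i(w.t, p). *)
Definition control_rhs (R : realType) (Omega M : topologicalType) (d m : nat)
    (sigma : R -> Omega -> Omega)
    (f0 : Omega -> M -> chart R M d -> 'rV[R]_d)
    (f : 'I_m -> Omega -> M -> chart R M d -> 'rV[R]_d)
    (w : Omega) (u : R -> 'rV[R]_m) (t : R) (p : M) (c : chart R M d) :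
    'rV[R]_d :=
  f0 (sigma t w) p c + \sum_(i < m) u t ord0 i *: f i (sigma t w) p c.

(* Caratheodory solution on the whole line: a continuous curve which, as long
   as it stays in a chart, satisfies there the integral equation (and hence is
   locally absolutely continuous and solves the differential equation a.e.). *)
Definition caratheodory_solution (R : realType) (Omega M : topologicalType)
    (d m : nat) (A : set (chart R M d)) (sigma : R -> Omega -> Omega)
    (f0 : Omega -> M -> chart R M d -> 'rV[R]_d)
    (f : 'I_m -> Omega -> M -> chart R M d -> 'rV[R]_d)
    (w : Omega) (u : R -> 'rV[R]_m) (x : R -> M) : Prop :=
  continuous x /\
  forall c, A c -> forall a b : R, a <= b ->
    (forall t, a <= t <= b -> cdom c (x t)) ->
    forall j : 'I_d,
      let g t := control_rhs sigma f0 f w u t (x t) c ord0 j in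
      (@lebesgue_measure R).-integrable `[a, b] (EFin \o g) /\
      cmap c (x b) ord0 j - cmap c (x a) ord0 j
        = \int[@lebesgue_measure R]_(t in `[a, b]) g t.

(* The metrics of Omega and M are those of their metricType structures. *)
Record control_system (R : realType) (Omega M : metricType R) (d m : nat) :=
  ControlSystem {
  atlas : set (chart R M d);
  atlas_smooth : smooth_atlas atlas;
  M_connected : connected [set: M];
  M_second_countable : @second_countable M;
  Omega_compact : compact [set: Omega];
  flow : R -> Omega -> Omega;
  flow_minimal : minimal_flow flow;
  drift : Omega -> M -> chart R M d -> 'rV[R]_d;
  fields : 'I_m -> Omega -> M -> chart R M d -> 'rV[R]_d;
  drift_continuous : continuous_to_TM atlas drift;
  fields_continuous : forall i, continuous_to_TM atlas (fields i);
  drift_C1 : forall w, C1_vector_field atlas (drift w);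
  fields_C1 : forall i w, C1_vector_field atlas (fields i w);
  Urange : set 'rV[R]_m;
  Urange_compact : compact Urange;
  Urange_convex : convex_set Urange;
  phi : R -> Omega -> M -> (R -> 'rV[R]_m) -> M;
  phi_solution : forall w x u, admissible Urange u ->
    caratheodory_solution atlas flow drift fields w u (fun t => phi t w x u) /\
    phi 0 w x u = x;
  phi_unique : forall w x u y, admissible Urange u ->
    caratheodory_solution atlas flow drift fields w u y -> y 0 = x ->
    forall t, y t = phi t w x u }.

Definition psi (R : realType) (Omega M : metricType R) (d m : nat)
    (S : control_system Omega M d m) (t : R) (p : Omega * M)
    (u : R -> 'rV[R]_m) : Omega * M :=
  (flow S t p.1, phi S t p.1 p.2 u).

(** * Controlled chains *)

(* Controlled (e, T)-chains with jump times in [T, 2T]. Only ws, xs at indices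
   j <= n and us, Ts at indices j < n are relevant. *)
Record controlled_chain (R : realType) (Omega M : metricType R) (d m : nat)
    (S : control_system Omega M d m) (e T : R) (p q : Omega * M)
    (n : nat) (ws : nat -> Omega) (xs : nat -> M)
    (us : nat -> R -> 'rV[R]_m) (Ts : nat -> R) : Prop := ControlledChain {
  chain_pos : (0 < n)%N;
  chain_start : (ws 0%N, xs 0%N) = p;
  chain_end : xs n = q.2;
  chain_controls : forall j, (j < n)%N -> admissible (Urange S) (us j);
  chain_times : forall j, (j < n)%N -> T <= Ts j <= 2 * T;
  chain_base : forall j, (j < n)%N -> flow S (Ts j) (ws j) = ws j.+1;
  chain_base_end : mdist (ws n) q.1 < e;
  chain_jumps : forall j, (j < n)%N ->
    mdist (phi S (Ts j) (ws j) (xs j) (us j)) (xs j.+1) < e }.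

Definition segments_in (R : realType) (Omega M : metricType R) (d m : nat)
    (S : control_system Omega M d m) (Q : set M)
    (n : nat) (ws : nat -> Omega) (xs : nat -> M)
    (us : nat -> R -> 'rV[R]_m) (Ts : nat -> R) : Prop :=
  forall j, (j < n)%N -> forall t, 0 <= t <= Ts j ->
    Q (phi S t (ws j) (xs j) (us j)).

Definition chains_between (R : realType) (Omega M : metricType R) (d m : nat)
    (S : control_system Omega M d m) (p q : Omega * M) : Prop :=
  forall e T : R, 0 < e -> 0 < T ->
    exists n ws xs us Ts, controlled_chain S e T p q n ws xs us Ts.

Definition chain_controllable (R : realType) (Omega M : metricType R)
    (d m : nat) (S : control_system Omega M d m) (A : set (Omega * M)) : Prop :=
  A !=set0 /\ forall p q, A p -> A q -> chains_between S p q.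

Definition chain_controllable_in (R : realType) (Omega M : metricType R)
    (d m : nat) (S : control_system Omega M d m) (Q : set M)
    (A : set (Omega * M)) : Prop :=
  A !=set0 /\ forall p q, A p -> A q -> forall e T : R, 0 < e -> 0 < T ->
    exists n ws xs us Ts, controlled_chain S e T p q n ws xs us Ts /\
                          segments_in S Q n ws xs us Ts.

Definition maximal_chain_controllable (R : realType) (Omega M : metricType R)
    (d m : nat) (S : control_system Omega M d m) (A : set (Omega * M)) : Prop :=
  chain_controllable S A /\
  forall B, chain_controllable S B -> A `<=` B -> B = A.

(* Maximality is among all chain controllable subsets of Omega * M. *)
Definition maximal_chain_controllable_in (R : realType)
    (Omega M : metricType R) (d m : nat) (S : control_system Omega M d m)
    (Q : set M) (A : set (Omega * M)) : Prop :=
  maximal_chain_controllable S A /\ chain_controllable_in S Q A.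

Definition viable_chain_transitive (R : realType) (Omega M : metricType R)
    (d m : nat) (S : control_system Omega M d m) (E : set (Omega * M)) : Prop :=
  (forall p, E p -> exists2 u, admissible (Urange S) u & forall t, E (psi S t p u))
  /\ (forall p q, E p -> E q -> chains_between S p q).

Definition chain_control_set (R : realType) (Omega M : metricType R)
    (d m : nat) (S : control_system Omega M d m) (E : set (Omega * M)) : Prop :=
  [/\ E !=set0, viable_chain_transitive S E &
      forall E', viable_chain_transitive S E' -> E `<=` E' -> E' = E].

(* The points met up to e by the chains between points of the fiber Fw0.
   The equality w = ws i . tau is exact, so this set is empty as soon as w0 is
   not a periodic point of the flow: w would be w0 . s for arbitrarily large s. *)
Definition chain_hull (R : realType) (Omega M : metricType R) (d m : nat)
    (S : control_system Omega M d m) (w0 : Omega) (Fw0 : set M) :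
    set (Omega * M) :=
  [set wz | exists x0 y0, Fw0 x0 /\ Fw0 y0 /\
    forall e T : R, 0 < e -> 0 < T ->
      exists n ws xs us Ts,
        controlled_chain S e (3 * T) (w0, x0) (w0, y0) n ws xs us Ts /\
        exists i tau, [/\ (i < n)%N, T <= tau <= 2 * T,
          wz.1 = flow S tau (ws i) &
          mdist wz.2 (phi S tau (ws i) (xs i) (us i)) < e]].

(* Main.v *)
(* The relation [chains_between] is transitive: the end of a first chain may miss
   the base point of the second one, but a chain survives a small perturbation
   of its initial base point. Every point of the hull is reached by chains from
   the fibre, and chains lead from it back to the fibre, so the hull is chain
   controllable.

   A maximal chain controllable set A is itself a chain control set. Weak
   compactness of the set of controls and uniqueness of solutions imply, without
   any Gronwall estimate, that solutions depend continuously on base point,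
   initial point and control, for the weak topology on controls. For p in A, let
   u be a weak limit of the controls of the first segments of (1/k, k)-chains
   from p to p and, in negative time, of the shifted controls of the last
   segments. Chains join p in both directions to every point of the trajectory of
   u through p, which therefore stays in A by maximality. *)

Require Import Defs.
From HB Require Import structures.
From mathcomp Require Import all_boot all_order all_algebra.
From mathcomp Require Import all_classical all_reals all_analysis.
From mathcomp Require Import measurable_realfun ess_sup_inf ring lra.

Set Implicit Arguments.
Unset Strict Implicit.
Unset Printing Implicit Defensive.

Import Order.TTheory GRing.Theory Num.Theory.
Import numFieldNormedType.Exports.

Local Open Scope classical_set_scope.
Local Open Scope ring_scope.

(** * Integrals over intervals *)

(** Limits are taken along ultrafilters: there every quantity with values in a compact set
    converges, so no subsequence is extracted, and the pointwise limit over uncountably many times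
    comes at once.

    Uniqueness is given for solutions on all of [R], whereas limits of trajectories are first
    obtained on short time windows inside one chart. Hence the solutions on intervals, which are
    glued to global ones before uniqueness is applied.

    Entering a chain near one of its segments requires a precision that is fixed before the control
    of that segment is known; this is why continuity in the initial point must be uniform in the
    control.

    Jump times have the upper bound [2 * T], so a prolonged or truncated segment has to be cut again
    into pieces of admissible length. In the definition of the hull, a segment of length at least
    [3 * T] that is met at a time in [[T, 2 * T]] leaves at least [T] on both sides. *)

Lemma lebesgue_ae_filter (R : realType) :
  Filter (almost_everywhere (@lebesgue_measure R)).
Proof. exact: ae_filter_ringOfSetsType. Qed.
#[local] Existing Instance lebesgue_ae_filter.

Section integral_lemmas.
Context {R : realType}.
Local Notation mu := (@lebesgue_measure R).
Implicit Types (f g : R -> R) (a b c C : R).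

Lemma Rintegral_itv_cat f a c b : a <= c -> c <= b ->
  mu.-integrable `[a, b] (EFin \o f) ->
  \int[mu]_(t in `[a, b]) f t =
    \int[mu]_(t in `[a, c]) f t + \int[mu]_(t in `[c, b]) f t.
Proof.
move=> ac cb fi; apply/eqP; rewrite addrC -subr_eq; apply/eqP.
rewrite Rintegral_itvB// ?bnd_simp// Rintegral_itv_obnd_cbnd//.
by apply: integrableS fi => //; apply: subset_itvr; rewrite bnd_simp.
Qed.

Lemma integrable_ae_bounded f a b C :
  measurable_fun `[a, b] f -> {ae mu, forall t, t \in `[a, b] -> `|f t| <= C} ->
  mu.-integrable `[a, b] (EFin \o f).
Proof.
move=> mf fC; apply/integrableP; split; first exact/measurable_EFinP.
have ab_fin : (mu `[a, b]%classic < +oo)%E.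
  by apply: compact_finite_measure; exact: segment_compact.
apply: (@le_lt_trans _ _ (\int[mu]_(t in `[a, b]) (cst `|C|%:E t))%E).
  apply: ae_ge0_le_integral => //.
  - by apply: measurableT_comp => //; exact/measurable_EFinP.
  - by move=> t _; rewrite lee_fin.
  apply: filterS fC => t /= h tab.
  by rewrite lee_fin (le_trans (h tab))// ler_norm.
by rewrite integral_cst// lte_mul_pinfty.
Qed.

Lemma Rintegral_ae_bound f a b C : a <= b -> 0 <= C ->
  mu.-integrable `[a, b] (EFin \o f) ->
  {ae mu, forall t, t \in `[a, b] -> `|f t| <= C} ->
  `|\int[mu]_(t in `[a, b]) f t| <= C * (b - a).
Proof.
move=> ab C0 fi fC.
apply: (le_trans (le_normr_Rintegral _ fi)) => //.
have ab_fin : (mu `[a, b]%classic < +oo)%E.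
  by apply: compact_finite_measure; exact: segment_compact.
have -> : C * (b - a) = \int[mu]_(t in `[a, b]) cst C t.
  rewrite Rintegral_cst//=; congr (_ * _).
  rewrite lebesgue_measure_itv/= lte_fin.
  by move: ab; rewrite le_eqVlt => /predU1P[->|->//]; rewrite ltxx subrr.
rewrite /Rintegral fine_le//.
- apply: integrable_fin_num => //.
  exact: (@integrable_norm _ _ _ mu).
- change ((\int[mu]_(x in `[a, b]) cst C%:E x)%E \is a fin_num).
  by rewrite integral_cst// fin_numM// ge0_fin_numE.
apply: ae_ge0_le_integral => //.
- apply/measurableT_comp/measurableT_comp => //.
  by move/integrableP : fi => [/measurable_EFinP].
- by apply/measurable_EFinP; exact: measurable_cst.
Qed.

Lemma eq_Rintegral_ae f g a b :
  mu.-integrable `[a, b] (EFin \o f) -> mu.-integrable `[a, b] (EFin \o g) ->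
  {ae mu, forall t, t \in `[a, b] -> f t = g t} ->
  \int[mu]_(t in `[a, b]) f t = \int[mu]_(t in `[a, b]) g t.
Proof.
move=> fi gi fg; rewrite /Rintegral; congr fine.
apply: ae_eq_integral => //.
- by case/integrableP: fi.
- by case/integrableP: gi.
by apply: filterS fg => t /= h tab; rewrite h.
Qed.

(** The retraction of the line onto [[a, b]]. Being 1-Lipschitz, it extends a function given on
    [[a, b]] to the whole line without spoiling Lipschitz bounds. *)
Definition clamp a b t := Num.max a (Num.min b t).

Lemma clamp_itv a b t : a <= b -> clamp a b t \in `[a, b].
Proof.
by move=> ab; rewrite in_itv /= /clamp le_max lexx /= ge_max ab ge_min lexx.
Qed.

Lemma clamp_id a b t : a <= t <= b -> clamp a b t = t.
Proof. by move=> /andP[at_ tb]; rewrite /clamp min_r// max_r. Qed.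

Lemma clamp_lipschitz a b s t : `|clamp a b s - clamp a b t| <= `|s - t|.
Proof.
have := ler_norm (s - t); have := ler_norm (t - s); rewrite distrC ler_norml.
by rewrite /clamp /Num.max /Num.min; do 4 case: ifPn; rewrite -?leNgt; lra.
Qed.

(** Composed with [clamp], the function has zero derivative at every point of the line, so it is
    constant. *)
Lemma eq_of_zero_rate f a b : a <= b ->
  (forall t, t \in `[a, b] -> forall e : R, 0 < e -> exists2 d : R, 0 < d &
     forall s, s \in `[a, b] -> `|s - t| < d -> `|f s - f t| <= e * `|s - t|) ->
  f a = f b.
Proof.
move=> ab fr.
pose cl := clamp a b.
have clab t : cl t \in `[a, b] by exact: clamp_itv.
have cl_lip s t : `|cl s - cl t| <= `|s - t| by exact: clamp_lipschitz.
have cla : cl a = a by rewrite /cl clamp_id// lexx.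
have clb : cl b = b by rewrite /cl clamp_id// lexx andbT.
rewrite -[in LHS]cla -[in RHS]clb; apply: (@is_derive_0_is_cst _ (f \o cl)) => t.
have cvg0 : h^-1 *: ((f \o cl) (h *: 1 + t) - (f \o cl) t) @[h --> 0^'] --> 0.
  apply/cvgrPdist_le => e e0.
  have [d d0 fd] := fr _ (clab t) e e0.
  near=> h.
  have hE : (h *: 1 + t) - t = h by rewrite addrK [_ *: _]mulr1.
  have hcl : `|cl (h *: 1 + t) - cl t| <= `|h| by rewrite -[in leRHS]hE.
  have h0 : h != 0 by near: h; exact: nbhs_dnbhs_neq.
  have hd : `|h| < d.
    near: h; apply: nbhs_dnbhs.
    by apply/nbhs_normP; exists d => //= h /=; rewrite sub0r normrN.
  rewrite sub0r normrN normrZ normfV ler_pdivrMl ?normr_gt0//.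
  rewrite mulrC (le_trans (fd _ (clab _) (le_lt_trans hcl hd)))//.
  by rewrite ler_pM2l.
apply: DeriveDef; first by apply/cvg_ex; exists 0.
exact: (cvg_lim _ cvg0).
Unshelve. all: by end_near. Qed.

Lemma Rintegrable_scale f a b c : mu.-integrable `[a, b] (EFin \o f) ->
  mu.-integrable `[a, b] (EFin \o (fun t => c * f t)).
Proof.
move=> fi; rewrite (_ : _ \o _ = fun t => (c%:E * (EFin \o f) t)%E).
  exact: integrableZl.
by apply/funext.
Qed.

Lemma Rintegrable_sub f g a b : mu.-integrable `[a, b] (EFin \o f) ->
  mu.-integrable `[a, b] (EFin \o g) ->
  mu.-integrable `[a, b] (EFin \o (fun t => f t - g t)).
Proof.
move=> fi gi.
rewrite (_ : _ \o _ = fun t => ((EFin \o f) t - (EFin \o g) t)%E).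
  exact: integrableB.
by apply/funext.
Qed.

Lemma Rintegral_sum n (w : 'I_n -> R -> R) a b :
  (forall l, mu.-integrable `[a, b] (EFin \o w l)) ->
  mu.-integrable `[a, b] (EFin \o (fun t => \sum_l w l t)) /\
  \int[mu]_(t in `[a, b]) \sum_l w l t = \sum_l \int[mu]_(t in `[a, b]) w l t.
Proof.
move=> wi; have -> : EFin \o (fun t => \sum_l w l t) =
    (fun t => \sum_l (EFin \o w l) t)%E by apply/funext => t /=; rewrite sumEFin.
split; first exact: integrable_sum.
rewrite /Rintegral.
under eq_integral do rewrite -sumEFin.
rewrite integral_sum// -sum_fine// => l _.
exact: integrable_fin_num (wi l).
Qed.

(** Almost everywhere the two integrands differ by at most [n * C * e]. Once the [H l] are frozen,
    only integrals of the [w l] remain, and those pass to weak limits. *)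
Lemma Rintegral_frozen n (w H : 'I_n -> R -> R) (c : 'I_n -> R) a b (C e : R) :
  a <= b -> 0 <= C -> 0 <= e ->
  (forall l, mu.-integrable `[a, b] (EFin \o w l)) ->
  (forall l, {ae mu, forall t, `|w l t| <= C}) ->
  (forall l t, t \in `[a, b] -> `|H l t - c l| <= e) ->
  mu.-integrable `[a, b] (EFin \o (fun t => \sum_l w l t * H l t)) ->
  `|\int[mu]_(t in `[a, b]) (\sum_l w l t * H l t) -
    \sum_l c l * \int[mu]_(t in `[a, b]) w l t| <= n%:R * C * e * (b - a).
Proof.
move=> ab C0 e0 wi wC He wHi.
have cwi l : mu.-integrable `[a, b] (EFin \o (fun t => c l * w l t)).
  exact: Rintegrable_scale.
have -> : \sum_l c l * \int[mu]_(t in `[a, b]) w l t =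
          \int[mu]_(t in `[a, b]) \sum_l c l * w l t.
  rewrite (Rintegral_sum cwi).2; apply: eq_bigr => l _.
  by rewrite RintegralZl.
rewrite -RintegralB//; last exact: (Rintegral_sum cwi).1.
apply: Rintegral_ae_bound => //.
- by rewrite !mulr_ge0.
- apply: Rintegrable_sub => //; exact: (Rintegral_sum cwi).1.
have : {ae mu, forall t, forall l, `|w l t| <= C}.
  exact: filter_forall.
apply: filterS => t /= wCt tab.
rewrite -sumrB (le_trans (ler_norm_sum _ _ _))//.
rewrite (@le_trans _ _ (\sum_(l < n) C * e))//; last first.
  by rewrite sumr_const card_ord -[leLHS]mulr_natl mulrA.
apply: ler_sum => l _; rewrite (mulrC (c l)) -mulrBr normrM.
by rewrite ler_pM// ?wCt// He.
Qed.

Lemma cvg_norm_le (I : Type) (F : set_system I) {FF : ProperFilter F}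
    (x : I -> R) (l B : R) :
  x i @[i --> F] --> l -> (\forall i \near F, `|x i| <= B) -> `|l| <= B.
Proof. by move=> /cvg_norm xl xB; exact: cvgr_to_le xl xB. Qed.

(* Freezing the [G' l] at [t] on short intervals around [t] shows that the
   difference of the two sides, as a function of [b], has zero derivative. *)
Lemma weak_limit_integral_equation (I : Type) (F : set_system I)
    {FF : ProperFilter F} n (v : I -> 'I_n -> R -> R) (v' : 'I_n -> R -> R)
    (G : I -> 'I_n -> R -> R) (G' : 'I_n -> R -> R)
    (X : I -> R -> R) (X' : R -> R) (C a b : R) :
  a <= b -> 0 <= C ->
  (forall i l, {ae mu, forall t, `|v i l t| <= C}) ->
  (forall l, {ae mu, forall t, `|v' l t| <= C}) ->
  (forall i l, mu.-integrable `[a, b] (EFin \o v i l)) ->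
  (forall l, mu.-integrable `[a, b] (EFin \o v' l)) ->
  (forall l s t, a <= s -> s <= t -> t <= b ->
    \int[mu]_(r in `[s, t]) v i l r @[i --> F] -->
    \int[mu]_(r in `[s, t]) v' l r) ->
  (forall l t, t \in `[a, b] -> forall e : R, 0 < e ->
    \forall s \near t & i \near F, s \in `[a, b] -> `|G i l s - G' l t| <= e) ->
  (forall t, t \in `[a, b] -> X i t @[i --> F] --> X' t) ->
  (\forall i \near F, forall s t, a <= s -> s <= t -> t <= b ->
    mu.-integrable `[s, t] (EFin \o (fun r => \sum_l v i l r * G i l r)) /\
    X i t - X i s = \int[mu]_(r in `[s, t]) \sum_l v i l r * G i l r) ->
  mu.-integrable `[a, b] (EFin \o (fun r => \sum_l v' l r * G' l r)) ->
  X' b - X' a = \int[mu]_(t in `[a, b]) \sum_l v' l t * G' l t.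
Proof.
move=> ab C0 vC v'C vi v'i weak Gcv Xcv Xeq G'i.
pose P t := \int[mu]_(r in `[a, t]) \sum_l v' l r * G' l r.
pose E t := X' t - X' a - P t.
suff : E a = E b.
  rewrite /E subrr sub0r /P set_itv1 Rintegral_set1 oppr0 => /esym/eqP.
  by rewrite subr_eq0 => /eqP.
apply: eq_of_zero_rate => // t tab e e0.
(* The two freezing errors below are [n * C * e1] and [n * C * (2 * e1)] per unit of time; the [+ 1]
   keeps the denominator positive. *)
pose e1 := e / (3 * n%:R * C + 1).
have D0 : 0 < 3 * n%:R * C + 1 by rewrite ltr_wpDl// !mulr_ge0.
have e10 : 0 < e1 by rewrite divr_gt0.
have : \forall s \near t & i \near F, forall l,
    s \in `[a, b] -> `|G i l s - G' l t| <= e1.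
  exact: (@filter_forall _ _ (fun l (z : R * I) =>
    z.1 \in `[a, b] -> `|G z.2 l z.1 - G' l t| <= e1) (filter_prod (nbhs t) F)
    _ (fun l => Gcv l t tab e1 e10)).
case=> -[A B] /= [At FB] AB.
have [d d0 dA] : exists2 d : R, 0 < d & forall s, `|s - t| < d -> A s.
  move/nbhs_normP : At => [d d0 dA]; exists d => // s sd.
  by apply: dA; rewrite /= distrC.
have GB i s l : B i -> `|s - t| < d -> s \in `[a, b] ->
    `|G i l s - G' l t| <= e1.
  by move=> Bi sd sab; exact: (AB (s, i) (conj (dA _ sd) Bi) l sab).
(* No continuity of [G'] is assumed: its oscillation is bounded through one [G i], with [i] good
   both near [t] and near [s]. *)
have G'B s l : `|s - t| < d -> s \in `[a, b] -> `|G' l s - G' l t| <= 2 * e1.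
  move=> sd sab.
  have [[A' B'] /= [A's FB'] AB'] := Gcv l s sab e1 e10.
  have [i [Bi B'i]] := @filter_ex _ F FF _ (filterI FB FB').
  have h1 := GB i s l Bi sd sab.
  have := AB' (s, i) (conj (nbhs_singleton A's) B'i) sab => /= h2.
  rewrite (_ : _ - _ = (G' l s - G i l s) + (G i l s - G' l t)); last by ring.
  by rewrite (le_trans (ler_normD _ _))// mulr_natl mulr2n lerD// distrC.
have key p q : a <= p -> p <= q -> q <= b ->
    (forall s, s \in `[p, q] -> `|s - t| < d) ->
    `|X' q - X' p - \int[mu]_(r in `[p, q]) \sum_l v' l r * G' l r| <=
      e * (q - p).
  move=> ap pq qb pqd.
  have pqab : [set` `[p, q]] `<=` [set` `[a, b]].
    by apply: subset_itv; rewrite bnd_simp.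
  have sub s : s \in `[p, q] -> s \in `[a, b] by move=> h; exact: pqab.
  (* [J] is the common frozen value. The first comparison is made for each [X i] and passed to the
     limit, the second directly for [v']. *)
  pose J := \sum_l G' l t * \int[mu]_(r in `[p, q]) v' l r.
  have h1 : `|X' q - X' p - J| <= n%:R * C * e1 * (q - p).
    apply: (@cvg_norm_le _ F _ (fun i => X i q - X i p -
      \sum_l G' l t * \int[mu]_(r in `[p, q]) v i l r)).
      apply: cvgB.
        apply: cvgB; apply: Xcv; rewrite in_itv /=; apply/andP; split => //.
        + exact: le_trans pq.
        + exact: le_trans qb.
      apply: cvg_big; first by move=> ?; exact: add_continuous.
      by move=> l _; apply: cvgM; [exact: cvg_cst|exact: weak].
    apply: filterS2 FB Xeq => i Bi /(_ p q ap pq qb)[gi ->].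
    apply: Rintegral_frozen => //.
    - exact: ltW.
    - by move=> l; exact: integrableS (vi i l).
    - by move=> l s spq; apply: GB => //; [exact: pqd|exact: sub].
  have h2 : `|\int[mu]_(r in `[p, q]) (\sum_l v' l r * G' l r) - J| <=
      n%:R * C * (2 * e1) * (q - p).
    apply: Rintegral_frozen => //.
    - by rewrite mulr_ge0// ltW.
    - by move=> l; exact: integrableS (v'i l).
    - by move=> l s spq; apply: G'B; [exact: pqd|exact: sub].
    - exact: integrableS G'i.
  set K := \int[mu]_(r in _) _ in h2 *.
  rewrite (_ : X' q - X' p - K = (X' q - X' p - J) - (K - J)); last by ring.
  rewrite (le_trans (ler_normB _ _))// (le_trans (lerD h1 h2))//.
  rewrite (_ : _ + _ = (3 * n%:R * C) * e1 * (q - p)); last by ring.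
  rewrite ler_wpM2r ?subr_ge0// /e1 mulrCA ger_pMr//.
  by rewrite ler_pdivrMr// mul1r lerDl.
exists d => // s sab sd.
have [ta tb] : a <= t /\ t <= b by move: tab; rewrite in_itv /= => /andP.
have [sa sb] : a <= s /\ s <= b by move: sab; rewrite in_itv /= => /andP.
have Pcat p q : a <= p -> p <= q -> q <= b ->
    E q - E p = X' q - X' p - \int[mu]_(r in `[p, q]) \sum_l v' l r * G' l r.
  move=> ap pq qb; rewrite /E /P (@Rintegral_itv_cat _ a p q)//.
    by ring.
  by apply: integrableS G'i => //; apply: subset_itvl; rewrite bnd_simp.
have [st|/ltW ts] := leP s t.
  rewrite distrC Pcat// (distrC s t) (ger0_norm (_ : 0 <= t - s)) ?subr_ge0//.
  apply: key => // r; rewrite in_itv /= => /andP[sr rt].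
  by move: sd; rewrite !ler0_norm ?subr_le0//; lra.
rewrite Pcat// (ger0_norm (_ : 0 <= s - t)) ?subr_ge0//.
apply: key => // r; rewrite in_itv /= => /andP[tr rs].
by move: sd; rewrite !ger0_norm ?subr_ge0//; lra.
Qed.

End integral_lemmas.

(** * Weak limits of bounded functions *)

Section measure_lemmas.
Context {R : realType}.
Local Notation mu := (@lebesgue_measure R).
Implicit Types (f : R -> R) (a b s : R).

Lemma measurable_shift s : measurable_fun setT (fun t : R => t + s).
Proof. exact: measurable_funD. Qed.

(** The image of [mu] under the translation agrees with [mu] on half-open intervals, which determine
    it. *)
Lemma lebesgue_measure_shift s (A : set R) : measurable A ->
  mu ((fun t => t + s) @^-1` A) = mu A.
Proof.
move=> mA.
pose f : {mfun (measurableTypeR R) >-> (measurableTypeR R)} :=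
  HB.pack (fun t : R => t + s) (isMeasurableFun.Build _ _
    (measurableTypeR R) (measurableTypeR R) _ (measurable_shift s)).
pose nu : {measure set (measurableTypeR R) -> \bar R} :=
  @pushforward _ _ (measurableTypeR R) (measurableTypeR R) R mu f.
apply/esym; apply: (lebesgue_measure_unique (mu := nu (measurable_shift s))) => // X.
case=> -[a b] _ <- /=; rewrite /nu /= /pushforward.
have -> : f @^-1` `]a, b] = `]a - s, b - s]%classic.
  by apply/seteqP; split => t /=; rewrite !in_itv /= ltrBlDr lerBrDr.
rewrite !lebesgue_measure_itv /= !lte_fin ltrD2r.
by case: ifP => // _; rewrite -!EFinD; congr _%:E; ring.
Qed.

Lemma ae_shift s (P : R -> Prop) :
  {ae mu, forall t, P t} -> {ae mu, forall t, P (t + s)}.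
Proof.
case=> N [mN N0 NP]; exists ((fun t => t + s) @^-1` N); split.
- by rewrite -[X in measurable X]setTI; exact: measurable_shift.
- by rewrite lebesgue_measure_shift.
- by move=> t /= Pt; exact: NP.
Qed.

Lemma preimage_shift_itv s a b :
  (fun t => t + s) @^-1` `[a + s, b + s] = `[a, b]%classic.
Proof. by apply/seteqP; split => t /=; rewrite !in_itv /= !lerD2r. Qed.

Lemma ge0_integral_shift (f : R -> \bar R) s a b :
  measurable_fun `[a + s, b + s] f -> (forall t, 0 <= f t)%E ->
  (\int[mu]_(t in `[a, b]) f (t + s)%R =
   \int[mu]_(t in `[(a + s)%R, (b + s)%R]) f t)%E.
Proof.
move=> mf f0.
pose g : {mfun (measurableTypeR R) >-> (measurableTypeR R)} :=
  HB.pack (fun t : R => (t + s)%R) (isMeasurableFun.Build _ _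
    (measurableTypeR R) (measurableTypeR R) _ (measurable_shift s)).
transitivity (\int[@pushforward _ _ (measurableTypeR R) (measurableTypeR R) R
    mu g]_(t in `[(a + s)%R, (b + s)%R]) f t)%E.
  rewrite ge0_integral_pushforward//.
  by rewrite -(preimage_shift_itv s a b).
apply: eq_measure_integral => A mA _.
exact: lebesgue_measure_shift.
Qed.

Lemma Rintegral_shift f s a b :
  mu.-integrable `[a + s, b + s] (EFin \o f) ->
  \int[mu]_(t in `[a, b]) f (t + s) = \int[mu]_(t in `[a + s, b + s]) f t.
Proof.
move=> /integrableP[mf fi]; rewrite /Rintegral; congr fine.
rewrite integralE [RHS]integralE; congr (_ - _)%E.
  transitivity (\int[mu]_(t in `[a, b]) (EFin \o f)^\+ (t + s)%R)%E.
    by apply: eq_integral => t _; rewrite !funeposE.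
  apply: ge0_integral_shift => //.
  exact: measurable_funepos.
transitivity (\int[mu]_(t in `[a, b]) (EFin \o f)^\- (t + s)%R)%E.
    by apply: eq_integral => t _; rewrite !funenegE.
  apply: ge0_integral_shift => //.
exact: measurable_funeneg.
Qed.

End measure_lemmas.

(** The space is cut into disjoint pieces [E j] of finite [nu]-measure, and the Radon-Nikodym
    densities of the restrictions of [nu] to them are summed. *)
Lemma sigma_finite_density d (T : measurableType d) (R : realType)
    (mu nu : {sigma_finite_measure set T -> \bar R}) : nu `<< mu ->
  exists f : T -> \bar R, [/\ forall x, (0 <= f x)%E, measurable_fun setT f &
    forall A, measurable A -> (nu A = \int[mu]_(x in A) f x)%E].
Proof.
move=> numu; have [F FT /all_and2[mF Foo]] := sigma_finiteT nu.
pose E := seqDU F.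
have mE k : measurable (E k) by apply: seqDU_measurable.
have Eoo k : (nu (E k) < +oo)%E.
  by rewrite (le_lt_trans _ (Foo k))// le_measure ?inE//; exact: subDsetl.
have UE : \bigcup_i E i = setT by rewrite FT [RHS]seqDU_bigcup_eq.
pose nuE j : {finite_measure set T -> \bar R} := mfrestr (mE j) (Eoo j).
have nuEmu j : nuE j `<< mu.
  move=> N muN B mB BN; rewrite /nuE /= /mfrestr /mrestr.
  by apply: (numu _ muN); [exact: measurableI|exact: subset_trans BN].
have /choice[f fP] j := radon_nikodym_sigma_finite (nuEmu j).
exists (fun x => \sum_(j <oo) f j x)%E.
have mf j : measurable_fun setT (f j).
  by have [_ _ /integrableP[]] := fP j.
have f0 j x : (0 <= f j x)%E by have [] := fP j.
split.
- by move=> x; apply: nneseries_ge0.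
- by apply: ge0_emeasurable_sum.
move=> A mA; rewrite integral_nneseries//; last first.
  by move=> j; exact: measurable_funTS.
rewrite -[in LHS](setIT A) -UE setI_bigcupr measure_bigcup//; last 2 first.
- by move=> i _; exact: measurableI.
- exact/trivIset_setIl/trivIset_seqDU.
rewrite (eq_eseriesl (Q := xpredT)); last by move=> i; rewrite in_setT.
apply: eq_eseriesr => j _; have [_ _ _ <-//] := fP j.
Qed.

Lemma fmap_ultra (I T : Type) (f : I -> T) (F : set_system I) :
  UltraFilter F -> UltraFilter (f @ F).
Proof.
move=> UF; split; first exact: fmap_proper_filter.
move=> G PG FG; apply/seteqP; split => // A GA.
have [//|FA] := in_ultra_setVsetC (f @^-1` A) UF.
have : G (A `&` ~` A) by apply: filterI => //; exact: FG.
by rewrite setICr => /filter_not_empty.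
Qed.

(** The substitute for extracting convergent subsequences. *)
Lemma ultra_compact_cvg (I : Type) (T : topologicalType) (F : set_system I)
    {UF : UltraFilter F} (f : I -> T) (K : set T) :
  compact K -> (\forall i \near F, K (f i)) ->
  exists l, K l /\ f i @[i --> F] --> l.
Proof.
rewrite compact_ultra => cK FK.
have [|l [Kl fl]] := cK (f @ F) _ FK; last by exists l.
exact: fmap_ultra.
Qed.

Section weak_density.
Context {R : realType}.
Local Notation mu := (@lebesgue_measure R).

(** A cover by half-open intervals has Stieltjes length at most [C + 1] times its Lebesgue length,
    and both measures are infima over such covers. The constant is [C + 1] because it gets inverted
    and [C] may be 0. *)
Lemma lipschitz_stieltjes_dominates (W : cumulative R R) (C : R) :
  (forall a b, a <= b -> W b - W a <= C * (b - a)) ->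
  lebesgue_stieltjes_measure W `<< mu.
Proof.
move=> WC.
have C0 : 0 <= C.
  have := WC 0 1 ler01; rewrite subr0 mulr1; apply: le_trans.
  by rewrite subr_ge0 (cumulative_is_nondecreasing W).
apply/null_content_dominatesP => A mA A0.
have K0 : 0 < C + 1 by rewrite ltr_wpDl.
apply/eqP; rewrite eq_le measure_ge0 andbT.
suff : ((C + 1)^-1%:E * lebesgue_stieltjes_measure W A <= mu A)%E.
  by rewrite A0 lee_pdivrMl// mule0.
apply/le_ereal_inf_tmp => x [G [mG AG] <-{x}].
rewrite lee_pdivrMl// -nneseriesZl//.
apply: (@le_trans _ _ (\sum_(k <oo) wlength W (G k))%E).
  by apply: ereal_inf_lbound; exists G.
apply: lee_nneseries => [i _ _|i _]; first exact: wlength_ge0.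
have /ocitvP[->|[[a b] /= ab ->]] := mG i; first
  by rewrite wlength0 mule_ge0 ?wlength_ge0// lee_fin ltW.
rewrite !wlength_itv_bnd ?(ltW ab)// -EFinM lee_fin (le_trans (WC _ _ (ltW ab)))//.
by rewrite ler_wpM2r ?lerDl//= subr_ge0 ltW.
Qed.

Lemma Rintegral_stieltjes_density (W : cumulative R R) (C : R) :
  (forall a b, a <= b -> W b - W a <= C * (b - a)) ->
  exists f : R -> R, measurable_fun setT f /\ forall a b, a <= b ->
    mu.-integrable `[a, b] (EFin \o f) /\
    \int[mu]_(t in `[a, b]) f t = W b - W a.
Proof.
move=> WC.
have [f [f0 mf fE]] := sigma_finite_density (lipschitz_stieltjes_dominates WC).
exists (fine \o f); split; first exact: measurableT_comp.
have fint a b : a <= b ->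
    (\int[mu]_(t in `]a, b]) f t = (W b - W a)%:E)%E.
  move=> ab; rewrite -fE//; transitivity (wlength W `]a, b]).
    exact: measurable_mu_extE (is_ocitv a b).
  exact: wlength_itv_bnd.
have fintegrable a b : a <= b -> mu.-integrable `[a, b] f.
  (* The integrals of the density are known on half-open intervals, hence the margin on the left. *)
  move=> ab; apply: (@integrableS _ _ _ mu `]a - 1, b]%classic) => //.
    by apply: subset_itvr; rewrite bnd_simp ltrBlDr ltrDl.
  apply/integrableP; split; first exact: measurable_funTS.
  under eq_integral do rewrite gee0_abs//.
  by rewrite fint ?ltry// (le_trans _ ab)// lerBlDr lerDl.
move=> a b ab.
(* The density takes extended real values but is finite almost everywhere on [[a, b]], so [fine]
   leaves the integrals unchanged. *)
have fin_ae : {ae mu, forall t, t \in `[a, b] -> ((fine \o f) t)%:E = f t}.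
  have : {ae mu, forall t, `[a, b]%classic t -> f t \is a fin_num}.
    by apply: integrable_ae => //; exact: fintegrable.
  by apply: filterS => t /= h tab; rewrite fineK// h.
have mfab : measurable_fun `[a, b] f by exact: measurable_funTS.
have intE : (\int[mu]_(t in `[a, b]) (EFin \o (fine \o f)) t =
    \int[mu]_(t in `[a, b]) f t)%E.
  apply: ae_eq_integral => //.
  by apply/measurable_EFinP; apply: measurable_funTS; exact: measurableT_comp.
split.
  apply/integrableP; split.
    by apply/measurable_EFinP; apply: measurable_funTS; exact: measurableT_comp.
  have /integrableP[_] := fintegrable _ _ ab; apply: le_lt_trans.
  apply: ae_ge0_le_integral => //.
  - apply: measurableT_comp => //.
    by apply/measurable_EFinP; apply: measurable_funTS; exact: measurableT_comp.
  - exact: measurableT_comp.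
  - by apply: filterS fin_ae => t /= h tab; rewrite -(h tab).
rewrite /Rintegral intE -integral_itv_obnd_cbnd; last first.
  exact: measurable_funTS.
by rewrite fint.
Qed.

(* The primitives of the [v i] are [C]-Lipschitz and converge pointwise. Adding
   [C * t] to their limit makes it the distribution function of a Stieltjes
   measure, whose Radon-Nikodym density is [w + C]. *)
Lemma weak_density (I : Type) (F : set_system I) {UF : UltraFilter F}
    (v : I -> R -> R) (C : R) : 0 <= C ->
  (forall i, measurable_fun setT (v i)) -> (forall i t, `|v i t| <= C) ->
  exists w : R -> R, measurable_fun setT w /\ forall a b, a <= b ->
    mu.-integrable `[a, b] (EFin \o w) /\
    \int[mu]_(t in `[a, b]) v i t @[i --> F] --> \int[mu]_(t in `[a, b]) w t.
Proof.
move=> C0 mv vC.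
have FF : ProperFilter F by exact: ultra_proper.
have vi i a b : mu.-integrable `[a, b] (EFin \o v i).
  apply: (@integrable_ae_bounded _ _ _ _ C); first exact: measurable_funTS.
  by apply: aeW => t _.
(* The signed primitive from 0: integrals over reversed intervals are 0, so at most one of the two
   terms survives. *)
pose P i t := \int[mu]_(r in `[0, t]) v i r - \int[mu]_(r in `[t, 0]) v i r.
have Rint0 (f : R -> R) (a b : R) : b <= a -> \int[mu]_(r in `[a, b]) f r = 0.
  rewrite le_eqVlt => /predU1P[->|ba]; first by rewrite set_itv1 Rintegral_set1.
  by rewrite set_itv_ge ?Rintegral_set0// bnd_simp -ltNge.
have Pcat i a b : a <= b -> P i b - P i a = \int[mu]_(r in `[a, b]) v i r.
  move=> ab; rewrite /P.
  have [a0|/ltW a0] := leP 0 a.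
    rewrite (Rint0 _ b 0) ?(le_trans a0)// (Rint0 _ a 0)//.
    by rewrite (@Rintegral_itv_cat _ _ 0 a b)//; ring.
  have [b0|/ltW b0] := leP 0 b.
    rewrite (Rint0 _ b 0)// (Rint0 _ 0 a)// (@Rintegral_itv_cat _ _ a 0 b)//.
    by ring.
  rewrite (Rint0 _ 0 a)// (Rint0 _ 0 b)// (@Rintegral_itv_cat _ _ a b 0)//.
  by ring.
have vbound i a b : a <= b -> `|\int[mu]_(r in `[a, b]) v i r| <= C * (b - a).
  by move=> ab; apply: Rintegral_ae_bound => //; apply: aeW => t _.
have P0 i : P i 0 = 0 by rewrite /P subrr.
have PC i t : `|P i t| <= C * `|t|.
  have [t0|/ltW t0] := leP 0 t.
    have := vbound i 0 t t0; by rewrite -Pcat// P0 !subr0 (ger0_norm t0).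
  have := vbound i t 0 t0; by rewrite -Pcat// P0 !sub0r normrN (ler0_norm t0).
have /choice[V VP] t : exists l : R, P i t @[i --> F] --> l.
  have [|l [_ Pl]] := ultra_compact_cvg (f := P ^~ t)
    (@segment_compact R (- (C * `|t|)) (C * `|t|)); last by exists l.
  by apply: nearW => i /=; rewrite in_itv /= -ler_norml.
have Vint a b : a <= b -> \int[mu]_(r in `[a, b]) v i r @[i --> F] --> V b - V a.
  by move=> ab; under eq_fun do rewrite -Pcat//; apply: cvgB; exact: VP.
have VC a b : a <= b -> `|V b - V a| <= C * (b - a).
  move=> ab; apply: cvg_norm_le (Vint a b ab) _.
  by apply: nearW => i; exact: vbound.
pose W t := V t + C * t.
have Wnd : nondecreasing W.
  move=> a b ab; have := VC a b ab; rewrite ler_norml /W => /andP[h _].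
  by rewrite -subr_ge0 (_ : _ - _ = V b - V a - - (C * (b - a))) ?subr_ge0//; ring.
have WC a b : a <= b -> W b - W a <= 2 * C * (b - a).
  move=> ab; have := VC a b ab; rewrite ler_norml /W => /andP[_ h].
  rewrite (_ : _ - _ = (V b - V a) + C * (b - a)); last by ring.
  by rewrite -mulrA mulr_natl mulr2n lerD2r.
have Wrc : right_continuous W.
  apply: right_continuousW => t; apply/cvgrPdist_le => e e0.
  near=> s.
  apply: (@le_trans _ _ (2 * C * `|t - s|)).
    have [st|/ltW ts] := leP s t.
      by rewrite !ger0_norm ?subr_ge0 ?Wnd// WC.
    by rewrite !ler0_norm ?subr_le0 ?Wnd// !opprB WC.
  apply: (@le_trans _ _ (2 * C * (e / (2 * C + 1)))).
    rewrite ler_wpM2l ?mulr_ge0//; near: s.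
    by apply: (@cvgr_dist_le _ _ _ _ _ id) => //; rewrite divr_gt0// ltr_wpDl// mulr_ge0.
  by rewrite mulrCA ger_pMr// ler_pdivrMr ?mul1r ?lerDl// ltr_wpDl// mulr_ge0.
pose Wc : cumulative R R := HB.pack W (isCumulative.Build R _ R W Wnd Wrc).
have [f [mf fE]] := @Rintegral_stieltjes_density Wc _ WC.
exists (fun t => f t - C); split; first exact: measurable_funB.
move=> a b ab; have [fi fW] := fE a b ab.
have Ci : mu.-integrable `[a, b] (EFin \o cst C).
  apply: (@integrable_ae_bounded _ _ _ _ C); first exact: measurable_cst.
  by apply: aeW => t _ /=; rewrite ger0_norm.
split; first exact: Rintegrable_sub.
rewrite RintegralB// fW Rintegral_cst//.
have -> : Wc b - Wc a - C * fine (mu `[a, b]) = V b - V a.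
  rewrite lebesgue_measure_itv/= lte_fin /W.
  by move: ab; rewrite le_eqVlt => /predU1P[->|->] /=; rewrite ?ltxx /=; ring.
exact: Vint.
Unshelve. all: by end_near. Qed.

End weak_density.

(** * Weak compactness of the controls *)

Section controls.
Context {R : realType}.
Local Notation mu := (@lebesgue_measure R).

Lemma row_coord_le_norm n (x : 'rV[R]_n) i : `|x ord0 i| <= `|x|.
Proof.
rewrite -[leRHS]/(mx_norm x) mx_normrE.
exact: (le_bigmax _ (fun ij : 'I_1 * 'I_n => `|x ij.1 ij.2|) (ord0, i)).
Qed.

Lemma row_norm_le n (x : 'rV[R]_n) (C : R) : 0 <= C ->
  (forall i, `|x ord0 i| <= C) -> `|x| <= C.
Proof.
move=> C0 xC; rewrite -[leLHS]/(mx_norm x) mx_normrE.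
by apply/bigmax_leP; split => // -[i j] _ /=; rewrite (ord1 i).
Qed.

Lemma cvg_row (I : Type) (F : set_system I) {FF : Filter F} n
    (x : I -> 'rV[R]_n) (l : 'rV[R]_n) :
  (forall j, x i ord0 j @[i --> F] --> l ord0 j) -> x i @[i --> F] --> l.
Proof.
move=> xl; apply/cvgrPdist_le => e e0.
have : \forall i \near F, forall j, `|l ord0 j - x i ord0 j| <= e.
  by apply: filter_forall => j; move/cvgrPdist_le : (xl j); exact.
apply: filterS => i lx; apply: row_norm_le; first exact: ltW.
by move=> j; rewrite !mxE.
Qed.

Lemma compact_row_bound n (U : set 'rV[R]_n) : compact U ->
  exists2 C : R, 0 <= C & forall x i, U x -> `|x ord0 i| <= C.
Proof.
move=> /compact_bounded [M [_ UM]]; exists (`|M| + 1); first by rewrite addr_ge0.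
move=> x i Ux; apply: le_trans (row_coord_le_norm _ _) _.
by apply: UM => //; rewrite ltr_pwDr// ler_norm.
Qed.

(** Essential boundedness follows from [U] being bounded, so only measurability and the values have
    to be followed under shifts, concatenations and limits. *)
Lemma admissibleP n (U : set 'rV[R]_n) (u : R -> 'rV[R]_n) : compact U ->
  admissible U u <->
  (forall i, measurable_fun setT (fun t => u t ord0 i)) /\
  {ae mu, forall t, U (u t)}.
Proof.
move=> cU; have [C C0 UC] := compact_row_bound cU.
split=> -[uL uU]; split => // i.
  by have /andP[+ _] := uL i; rewrite inE.
apply/andP; split; apply: mem_set => /=; first exact: uL.
rewrite /finite_norm unlock.
case: ifPn => // _; apply: (@le_lt_trans _ _ C%:E); last exact: ltry.
apply/ess_supP; apply: filterS uU => t Ut /=; rewrite lee_fin; exact: UC.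
Qed.

Lemma Rintegral_ae_ge0 (f : R -> R) a b :
  mu.-integrable `[a, b] (EFin \o f) ->
  {ae mu, forall t, t \in `[a, b] -> 0 <= f t} ->
  0 <= \int[mu]_(t in `[a, b]) f t.
Proof.
move=> fi f0; rewrite (@eq_Rintegral_ae _ f (fun t => `|f t|))//.
- exact: Rintegral_ge0.
- exact: (@integrable_norm _ _ _ mu).
by apply: filterS f0 => t h tab; rewrite ger0_norm// h.
Qed.

(* [p] is the point of [U] closest to [y] *)
Lemma convex_compact_separation n (U : set 'rV[R]_n) (y : 'rV[R]_n) :
  compact U -> convex_set U -> U !=set0 ->
  exists2 p, U p & forall v, U v ->
    0 <= \sum_(l < n) (p ord0 l - y ord0 l) * (v ord0 l - p ord0 l).
Proof.
move=> cU vU U0.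
pose f (v : 'rV[R]_n) := \sum_(l < n) (v ord0 l - y ord0 l) ^+ 2.
have cf : continuous f.
  apply: continuous_big; first by move=> ?; exact: add_continuous.
  move=> l _ v.
  have h : (z ord0 l - y ord0 l) @[z --> v] --> v ord0 l - y ord0 l.
    by apply: cvgB; [exact: coord_continuous|exact: cvg_cst].
  exact: (cvgM h h).
have [p Up pmin] := EVT_min_rV U0 cU (continuous_subspaceT cf).
have {}Up : U p by rewrite inE in Up.
exists p => // v Uv.
set a := \sum_(l < n) _.
pose b := \sum_(l < n) (v ord0 l - p ord0 l) ^+ 2.
have b0 : 0 <= b by apply: sumr_ge0 => l _; exact: sqr_ge0.
(* At the point [s *: v + (1 - s) *: p] of [U], the squared distance to [y] exceeds its minimum by
   [s * (2 * a + s * b)]. *)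
have key (s : R) : 0 < s -> s <= 1 -> 0 <= 2 * a + s * b.
  move=> s0 s1.
  have /set_mem Uw := vU v p (Itv01 (ltW s0) s1) (mem_set Uv) (mem_set Up).
  have := pmin _ (mem_set Uw).
  have convE : conv (Itv01 (ltW s0) s1) (v : convex_lmodType 'rV[R]_n) p =
    s *: v + (1 - s) *: p by [].
  rewrite convE.
  have -> : f (s *: v + (1 - s) *: p) = f p + s * (2 * a + s * b).
    rewrite /f /a /b !mulr_sumr -!big_split /= mulr_sumr -big_split /=.
    by apply: eq_bigr => l _; rewrite !mxE; ring.
  by rewrite lerDl pmulr_rge0.
rewrite leNgt; apply/negP => a0.
(* For this [s], [s * b <= - a], hence [2 * a + s * b <= a < 0]. *)
have := key (Num.min 1 (- a / (b + 1))).
have b1 : 0 < b + 1 by rewrite ltr_wpDl.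
have h0 : 0 < - a / (b + 1) by rewrite divr_gt0// oppr_gt0.
rewrite lt_min ltr01 h0 ge_min lexx => /(_ isT isT).
apply/negP; rewrite -ltNge.
apply: (@le_lt_trans _ _ (2 * a + (- a / (b + 1)) * (b + 1))).
  rewrite lerD2l; apply: ler_pM => //; last by rewrite lerDl.
    by rewrite le_min ler01 ltW.
  by rewrite ge_min lexx orbT.
by rewrite divfK ?gt_eqF//; lra.
Qed.

(** Let [p] be the point of [U] closest to the average [y]. The integral over [[a, b]] of the
    separation inequality at [u t] is [- (b - a)] times the squared distance from [p] to [y]; being
    nonnegative, it forces [y = p]. *)
Lemma average_in_convex n (U : set 'rV[R]_n) (u : R -> 'rV[R]_n) a b :
  compact U -> convex_set U -> a < b ->
  (forall l, measurable_fun setT (fun t => u t ord0 l)) ->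
  {ae mu, forall t, U (u t)} ->
  U (\row_l ((b - a)^-1 * \int[mu]_(t in `[a, b]) u t ord0 l)).
Proof.
move=> cU vU ab mu_ uU.
have ba0 : 0 < b - a by rewrite subr_gt0.
have [C C0 UC] := compact_row_bound cU.
(* A property that holds almost everywhere holds somewhere, because the measure is not zero. *)
have U0 : U !=set0.
  have [|t Ut] := @filter_ex _ _ _ _ uU; last by exists (u t).
  apply: (@ae_properfilter_algebraOfSetsType _ _ _ mu).
  apply: (@lt_le_trans _ _ (mu `[a, b]%classic)).
    by rewrite lebesgue_measure_itv /= lte_fin ab -EFinD lte_fin.
  by apply: le_measure; rewrite ?inE.
set y := \row_l _.
have [p Up pmin] := convex_compact_separation y cU vU U0.
have ui l : mu.-integrable `[a, b] (EFin \o (fun t => u t ord0 l)).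
  apply: (@integrable_ae_bounded _ _ _ _ C); first exact: measurable_funTS.
  by apply: filterS uU => t Ut _; exact: UC.
have ci c : mu.-integrable `[a, b] (EFin \o (fun=> c)).
  apply: (@integrable_ae_bounded _ _ _ _ `|c|); first exact: measurable_cst.
  by apply: aeW => t _.
pose w l t := (p ord0 l - y ord0 l) * (u t ord0 l - p ord0 l).
have wi l : mu.-integrable `[a, b] (EFin \o w l).
  exact/Rintegrable_scale/Rintegrable_sub.
have : 0 <= \int[mu]_(t in `[a, b]) \sum_l w l t.
  apply: Rintegral_ae_ge0; first exact: (Rintegral_sum wi).1.
  by apply: filterS uU => t Ut _; exact: pmin.
rewrite (Rintegral_sum wi).2.
have wE l : \int[mu]_(t in `[a, b]) w l t =
    - (b - a) * (p ord0 l - y ord0 l) ^+ 2.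
  rewrite RintegralZl//; last exact: Rintegrable_sub.
  rewrite RintegralB// Rintegral_cst//.
  have -> : \int[mu]_(t in `[a, b]) u t ord0 l = (b - a) * y ord0 l.
    by rewrite mxE mulrA divff ?mul1r// gt_eqF.
  have muab : fine (mu `[a, b]%classic) = b - a.
    by rewrite lebesgue_measure_itv /= lte_fin ab.
  transitivity ((p ord0 l - y ord0 l) * ((b - a) * y ord0 l -
    p ord0 l * (b - a))); last by ring.
  by congr (_ * (_ - _ * _)).
under eq_bigr do rewrite wE.
rewrite -mulr_sumr mulNr oppr_ge0 pmulr_rle0// => py.
suff -> : y = p by [].
apply/rowP => l; apply/esym/eqP; rewrite -subr_eq0 -sqrf_eq0.
have s0 : \sum_i (p ord0 i - y ord0 i) ^+ 2 = 0.
  by apply/eqP; rewrite eq_le py sumr_ge0// => k _; exact: sqr_ge0.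
have h k : true -> 0 <= (p ord0 k - y ord0 k) ^+ 2 by move=> _; exact: sqr_ge0.
by rewrite (psumr_eq0P h s0).
Qed.

(* The averages of [w] over intervals are limits of those of the [u i], which
   lie in [U]; Lebesgue differentiation does the rest. *)
Lemma weak_limit_in_convex (I : Type) (F : set_system I) {FF : ProperFilter F} n
    (U : set 'rV[R]_n) (u : I -> R -> 'rV[R]_n) (w : R -> 'rV[R]_n) :
  compact U -> convex_set U -> (forall i, admissible U (u i)) ->
  (forall l, measurable_fun setT (fun t => w t ord0 l)) ->
  (forall l a b, a <= b ->
    mu.-integrable `[a, b] (EFin \o (fun t => w t ord0 l))) ->
  (forall l a b, a <= b ->
    \int[mu]_(t in `[a, b]) u i t ord0 l @[i --> F] -->
    \int[mu]_(t in `[a, b]) w t ord0 l) ->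
  {ae mu, forall t, U (w t)}.
Proof.
move=> cU vU uad mw wi uw.
have clU : closed U by exact: compact_closed (@norm_hausdorff _ _) cU.
have avg a b : a < b ->
    U (\row_l ((b - a)^-1 * \int[mu]_(t in `[a, b]) w t ord0 l)).
  move=> ab; apply: (closed_cvg (F := F) (u_ := fun i =>
    \row_l ((b - a)^-1 * \int[mu]_(t in `[a, b]) u i t ord0 l)) U) => //.
    apply: nearW => i; have [mui uUi] := (admissibleP _ cU).1 (uad i).
    exact: average_in_convex.
  apply: cvg_row => l; under eq_fun do rewrite mxE; rewrite mxE.
  by apply: cvgM; [exact: cvg_cst|exact/uw/ltW].
have : {ae mu, forall t, forall l, lebesgue_pt (fun t => w t ord0 l) t}.
  apply: filter_forall => l; apply: lebesgue_differentiation; split => //.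
    exact: openT.
  move=> K _ cK.
  have /compact_bounded [M [_ KM]] := cK.
  have KS : K `<=` `[- (`|M| + 1), `|M| + 1]%classic.
    move=> t Kt; rewrite /= in_itv /= -ler_norml; apply: KM => //.
    by rewrite ltr_pwDr// ler_norm.
  have M1 : - (`|M| + 1) <= `|M| + 1 by have := normr_ge0 M; lra.
  have /integrableP[_] := wi l _ _ M1; apply: le_lt_trans.
  apply: ge0_subset_integral => //; first exact: compact_measurable.
  apply/measurable_EFinP; apply: measurableT_comp => //.
  exact: measurable_funTS (mw l).
apply: filterS => x wx.
apply: (closed_cvg (F := 0^'+) (u_ := fun h : R => \row_l
  ((x + h - x)^-1 * \int[mu]_(t in `[x, x + h]) w t ord0 l)) U) => //.
  near=> h; apply: avg; rewrite ltrDl; near: h; exact: nbhs_right_gt.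
apply: cvg_row => l; under eq_fun do rewrite mxE.
have x1x : x < x + 1 by rewrite ltrDl.
(* The primitive starts at [x - 1] so that [x] is interior to the interval of integration. *)
have wint : mu.-integrable `[x - 1, x + 1] (EFin \o (fun t => w t ord0 l)).
  by apply: wi; lra.
have xx1 : (BLeft (x - 1)%R < BRight x)%E by rewrite lte_fin; lra.
have [dF dFE] := FTC1_lebesgue_pt x1x wint xx1 (wx l).
pose G y := \int[mu]_(t in `[x - 1, y]) w t ord0 l.
have : h^-1 *: (G (h *: 1 + x) - G x) @[h --> 0^'] --> w x ord0 l.
  by rewrite -dFE derive1E; exact: dF.
move/cvg_dnbhs_at_right; apply: cvg_trans; apply: near_eq_cvg.
near=> h.
have h0 : 0 < h by near: h; exact: nbhs_right_gt.
rewrite [x + h]addrC addrK /G [h *: 1]mulr1.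
rewrite (@Rintegral_itv_cat _ _ (x - 1) x (h + x)); [|lra|lra|].
  by rewrite addrAC subrr add0r.
by apply: wi; lra.
Unshelve. all: by end_near. Qed.

Lemma weak_compactness (I : Type) (F : set_system I) {UF : UltraFilter F} n
    (U : set 'rV[R]_n) (u : I -> R -> 'rV[R]_n) :
  compact U -> convex_set U -> (forall i, admissible U (u i)) ->
  exists2 w : R -> 'rV[R]_n, admissible U w & forall l a b, a <= b ->
    \int[mu]_(t in `[a, b]) u i t ord0 l @[i --> F] -->
    \int[mu]_(t in `[a, b]) w t ord0 l.
Proof.
move=> cU vU uad.
have [C C0 UC] := compact_row_bound cU.
(* [weak_density] asks for a bound at every time; truncation at [C] provides it and changes the
   controls on null sets only. *)
pose v l i t : R := Num.max (- C) (Num.min C (u i t ord0 l)).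
have mv l i : measurable_fun setT (v l i).
  have [mui _] := (admissibleP _ cU).1 (uad i).
  apply: measurable_maxr; first exact: measurable_cst.
  by apply: measurable_minr; [exact: measurable_cst|exact: mui].
have vC l i t : `|v l i t| <= C.
  by rewrite ler_norml /v le_max lexx /= ge_max ge_min lexx /= andbT ge0_cp.
have vE l i : {ae mu, forall t, u i t ord0 l = v l i t}.
  have [_] := (admissibleP _ cU).1 (uad i); apply: filterS => t Ut.
  have := UC _ l Ut; rewrite ler_norml => /andP[h1 h2].
  by rewrite /v min_r// max_r.
have vi l i a b : mu.-integrable `[a, b] (EFin \o v l i).
  apply: (@integrable_ae_bounded _ _ _ _ C); first exact: measurable_funTS.
  by apply: aeW => t _.
have ui l i a b : mu.-integrable `[a, b] (EFin \o (fun t => u i t ord0 l)).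
  have [mui uUi] := (admissibleP _ cU).1 (uad i).
  apply: (@integrable_ae_bounded _ _ _ _ C); first exact: measurable_funTS.
  by apply: filterS uUi => t Ut _; exact: UC.
have [w wP] := choice (fun l => weak_density C0 (mv l) (vC l)).
have wE t l : (\row_j w j t) ord0 l = w l t by rewrite mxE.
have weak l a b : a <= b -> \int[mu]_(t in `[a, b]) u i t ord0 l @[i --> F] -->
    \int[mu]_(t in `[a, b]) w l t.
  move=> ab; have [_ /(_ a b ab)[_]] := wP l.
  apply: cvg_trans; apply: near_eq_cvg; apply: nearW => i.
  by apply: eq_Rintegral_ae => //; apply: filterS (vE l i) => t + _.
exists (fun t => \row_j w j t); last first.
  by move=> l a b ab; under eq_Rintegral do rewrite mxE; exact: weak.
apply/admissibleP => //; split.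
  by move=> l; under eq_fun do rewrite mxE; have [] := wP l.
apply: (@weak_limit_in_convex I F _ n U u) => //.
- by move=> l; under eq_fun do rewrite mxE; have [] := wP l.
- move=> l a b ab; rewrite (_ : _ \o _ = EFin \o w l); last first.
    by apply/funext => t /=; rewrite mxE.
  by have [_ /(_ a b ab)[]] := wP l.
- by move=> l a b ab; under eq_Rintegral do rewrite mxE; exact: weak.
Qed.

Lemma admissible_shift n (U : set 'rV[R]_n) u s : compact U ->
  admissible U u -> admissible U (fun t => u (t + s)).
Proof.
move=> cU /(admissibleP _ cU)[mu_ uU]; apply/admissibleP => //; split.
  move=> i; apply: (measurableT_comp (mu_ i)); exact: measurable_shift.
exact: (@ae_shift _ s (fun t => U (u t))).
Qed.

Definition concat_control n s (u v : R -> 'rV[R]_n) t :=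
  if t <= s then u t else v (t - s).

Lemma admissible_concat n (U : set 'rV[R]_n) u v s : compact U ->
  admissible U u -> admissible U v -> admissible U (concat_control s u v).
Proof.
move=> cU uad /(admissible_shift (- s) cU) vad.
move: uad vad => /(admissibleP _ cU)[mu_ uU] /(admissibleP _ cU)[mv vU].
apply/admissibleP => //; split.
  move=> i; rewrite (_ : (fun t => _) = fun t =>
      if t <= s then u t ord0 i else v (t - s) ord0 i); last first.
    by apply/funext => t; rewrite /concat_control; case: ifP.
  apply: measurable_fun_ifT => //.
  by apply: measurable_fun_ler => //; exact: measurable_cst.
by apply: filterS2 uU vU => t Ut Vt; rewrite /concat_control; case: ifP.
Qed.

End controls.

(** * Trajectories *)

Section glue.
Context {R : realType} {T : topologicalType}.

Definition glue (b : R) (x1 x2 : R -> T) t := if t <= b then x1 t else x2 t.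

Lemma continuous_glue b x1 x2 : continuous x1 -> continuous x2 ->
  x1 b = x2 b -> continuous (glue b x1 x2).
Proof.
move=> c1 c2 eb.
have e : [set t | t <= b] `|` [set t | b <= t] = [set: R].
  by apply/seteqP; split => // t _ /=; case: (leP t b) => [|/ltW]; [left|right].
apply/continuous_subspace_setT; rewrite -e.
apply: withinU_continuous; [exact: closed_le|exact: closed_ge| |].
  apply: (@subspace_eq_continuous _ _ _ x1); last exact: continuous_subspaceT.
  by move=> t; rewrite inE /= /from_subspace /glue => ->.
apply: (@subspace_eq_continuous _ _ _ x2); last exact: continuous_subspaceT.
move=> t; rewrite inE /= /from_subspace /glue => bt.
by case: ifPn => // tb; have -> : t = b by apply/le_anti/andP.
Qed.

End glue.

Section solutions.
Context {R : realType} {Omega M : metricType R} {d m : nat}.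
Variable S : control_system Omega M d m.
Local Notation mu := (@lebesgue_measure R).
Local Notation adm := (admissible (Urange S)).
Local Notation rhs := (control_rhs (flow S) (drift S) (fields S)).
Implicit Types (w : Omega) (p q : M) (u v : R -> 'rV[R]_m) (x y : R -> M).

Lemma Urange_cpt : compact (Urange S).
Proof. by case: S. Qed.

Lemma flow_continuous : continuous (fun q : R * Omega => flow S q.1 q.2).
Proof. by have [] := flow_minimal S. Qed.

Lemma flow0 w : flow S 0 w = w.
Proof. by have [] := flow_minimal S. Qed.

Lemma flowD s t w : flow S (s + t) w = flow S s (flow S t w).
Proof. by have [] := flow_minimal S. Qed.

Lemma cvg_flow (X : Type) (F : set_system X) {FF : Filter F} (T : X -> R)
    (W : X -> Omega) t w :
  T z @[z --> F] --> t -> W z @[z --> F] --> w ->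
  flow S (T z) (W z) @[z --> F] --> flow S t w.
Proof.
move=> Tt Ww.
exact: (@continuous2_cvg _ _ _ _ F FF T W (fun t w => flow S t w) t w
  (@flow_continuous (t, w)) Tt Ww).
Qed.

(* The drift is treated as one more control field, with constant control 1. *)
Definition ext_control u (l : 'I_m.+1) (t : R) : R :=
  if unlift ord0 l is Some i then u t ord0 i else 1.

Definition ext_field (l : 'I_m.+1) w p (c : chart R M d) : 'rV[R]_d :=
  if unlift ord0 l is Some i then fields S i w p c else drift S w p c.

Lemma control_rhsE w u t p c j : rhs w u t p c ord0 j =
  \sum_l ext_control u l t * ext_field l (flow S t w) p c ord0 j.
Proof.
rewrite /control_rhs !mxE summxE big_ord_recl /ext_control /ext_field.
rewrite unlift_none mul1r; congr (_ + _).
by apply: eq_bigr => i _; rewrite !liftK mxE.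
Qed.

Lemma cvg_ext_field (X : Type) (F : set_system X) {FF : Filter F}
    (W : X -> Omega) (P : X -> M) w p l c j :
  atlas S c -> cdom c p -> W z @[z --> F] --> w -> P z @[z --> F] --> p ->
  ext_field l (W z) (P z) c ord0 j @[z --> F] --> ext_field l w p c ord0 j.
Proof.
move=> Sc cp Ww Pp.
have fc : {for (w, p), continuous (fun q : Omega * M => ext_field l q.1 q.2 c)}.
  rewrite /ext_field; case: unlift => [i|].
    exact: fields_continuous Sc _ _ cp.
  exact: drift_continuous Sc _ _ cp.
have h : ext_field l (W z) (P z) c @[z --> F] --> ext_field l w p c.
  exact: (@continuous2_cvg _ _ _ _ F FF W P (fun w p => ext_field l w p c) w p
    fc Ww Pp).
exact: (cvg_comp _ _ h (@coord_continuous _ _ _ ord0 j _)).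
Qed.

Lemma ext_control_bound : exists2 C : R, 0 <= C & forall u l, adm u ->
  {ae mu, forall t, `|ext_control u l t| <= C}.
Proof.
have [C C0 UC] := compact_row_bound Urange_cpt.
(* The [+ 1] covers the constant control 1 of the drift. *)
exists (C + 1); first by rewrite addr_ge0.
move=> u l [_]; apply: filterS => t Ut; rewrite /ext_control.
case: unlift => [i|]; last by rewrite normr1 lerDr.
by rewrite (le_trans (UC _ i Ut))// lerDl.
Qed.

Lemma measurable_ext_control u l : adm u -> measurable_fun setT (ext_control u l).
Proof.
move=> /(admissibleP _ Urange_cpt)[mu_ _]; rewrite /ext_control.
by case: unlift => [i|]; [exact: mu_|exact: measurable_cst].
Qed.

Lemma integrable_ext_control u l a b : adm u ->
  mu.-integrable `[a, b] (EFin \o ext_control u l).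
Proof.
move=> uad; have [C C0 uC] := ext_control_bound.
apply: (@integrable_ae_bounded _ _ _ _ C).
  exact: measurable_funTS (measurable_ext_control l uad).
by apply: filterS (uC _ l uad) => t + _.
Qed.

(** Along a continuous curve on [[a, b]] the fields are bounded by compactness, and the controls are
    bounded almost everywhere. *)
Lemma rhs_integrable w u x c a b j : adm u -> continuous x -> atlas S c ->
  (forall t, a <= t <= b -> cdom c (x t)) ->
  mu.-integrable `[a, b] (EFin \o (fun t => rhs w u t (x t) c ord0 j)).
Proof.
move=> uad cx Sc xc.
pose h l t : R := ext_field l (flow S t w) (x t) c ord0 j.
have ch l : {within `[a, b], continuous (h l)}.
  apply: continuous_in_subspaceT => t /set_mem /=; rewrite in_itv /= => tab.
  apply: cvg_ext_field => //; first exact: xc.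
  - by apply: cvg_flow; [exact: cvg_id|exact: cvg_cst].
  - exact: cx.
have hB l : exists B : R, forall t, t \in `[a, b] -> `|h l t| <= B.
  have := continuous_compact (ch l) (@segment_compact R a b).
  move=> /compact_bounded [B [_ hB]]; exists (B + 1) => t tab.
  by apply: (hB (B + 1)); [rewrite ltrDl|exists t].
have [C C0 uC] := ext_control_bound.
have [B hBB] := choice hB.
rewrite (_ : _ \o _ = EFin \o (fun t => \sum_l ext_control u l t * h l t)).
  apply: (Rintegral_sum _).1 => l.
  apply: (@integrable_ae_bounded _ _ _ _ (C * B l)).
    apply: measurable_funM; first exact: measurable_funTS (measurable_ext_control l uad).
    apply: (@subspace_continuous_measurable_fun R `[a, b]%classic (h l)) => //.
    exact: ch.
  apply: filterS (uC _ l uad) => t ut tab.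
  by rewrite normrM ler_pM// hBB.
by apply/funext => t /=; rewrite control_rhsE.
Qed.

(* The integral equations of [caratheodory_solution] restricted to the time
   intervals contained in [J]; integrability is [rhs_integrable]. *)
Definition solves_in (J : set R) w u x : Prop :=
  forall c, atlas S c -> forall a b : R, a <= b ->
    (forall t, a <= t <= b -> J t) -> (forall t, a <= t <= b -> cdom c (x t)) ->
    forall j, cmap c (x b) ord0 j - cmap c (x a) ord0 j
      = \int[mu]_(t in `[a, b]) rhs w u t (x t) c ord0 j.

Lemma solves_inT w u x : adm u ->
  caratheodory_solution (atlas S) (flow S) (drift S) (fields S) w u x <->
  continuous x /\ solves_in setT w u x.
Proof.
move=> uad; split=> -[cx sx]; split => //.
  by move=> c Sc a b ab _ xc j; have [] := sx c Sc a b ab xc j.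
by move=> c Sc a b ab xc j; split; [exact: rhs_integrable|exact: sx].
Qed.

Lemma solves_inS J J' w u x : J' `<=` J -> solves_in J w u x -> solves_in J' w u x.
Proof.
move=> JJ xs c Sc a b ab abJ xc j; apply: xs => // t tab.
exact/JJ/abJ.
Qed.

Lemma solves_inTS J w u x : solves_in setT w u x -> solves_in J w u x.
Proof. exact: solves_inS. Qed.

Lemma solves_in_shift J s w u x : adm u -> continuous x -> solves_in J w u x ->
  solves_in [set t | J (t + s)] (flow S s w) (fun t => u (t + s))
    (fun t => x (t + s)).
Proof.
move=> uad cx xs c Sc a b ab abJ xc j.
have tr t : a + s <= t <= b + s -> t = (t - s) + s /\ a <= t - s <= b.
  by move=> /andP[h1 h2]; rewrite subrK lerBrDr lerBlDr h1.
have xc' t : a + s <= t <= b + s -> cdom c (x t).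
  by move=> h; have [e h'] := tr t h; rewrite e; exact: xc.
rewrite (xs c Sc (a + s) (b + s))//.
- rewrite -Rintegral_shift; last exact: rhs_integrable.
  by apply: eq_Rintegral => t _; rewrite !control_rhsE flowD.
- by rewrite lerD2r.
- by move=> t h; have [e h'] := tr t h; rewrite e; exact: abJ.
Qed.

(** The excepted time [s] is meant for the switching time of a concatenation, where [concat_control]
    still takes the value of the first control. *)
Lemma solves_in_ext J s w u v x y : adm u -> adm v -> continuous x ->
  continuous y -> (forall t, J t -> x t = y t) ->
  (forall t, J t -> t != s -> u t = v t) ->
  solves_in J w u x -> solves_in J w v y.
Proof.
move=> uad vad cx cy xy uv xs c Sc a b ab abJ yc j.
have xc t : a <= t <= b -> cdom c (x t).
  by move=> tab; rewrite xy; [exact: yc|exact: abJ].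
have Ja : J a by apply: abJ; rewrite lexx.
have Jb : J b by apply: abJ; rewrite ab lexx.
rewrite -!xy// xs//; apply: eq_Rintegral_ae; [exact: rhs_integrable..|].
exists [set s]; split => //; first exact: lebesgue_measure_set1.
move=> t /= /not_implyP[tab]; apply: contra_notP => /eqP ts.
rewrite in_itv /= in tab.
have xyt := xy t (abJ t tab).
rewrite !control_rhsE xyt; apply: eq_bigr => l _; congr (_ * _).
by rewrite /ext_control (uv t (abJ t tab) ts).
Qed.

Lemma solves_in_glue J b w u x1 x2 : adm u -> continuous x1 -> continuous x2 ->
  x1 b = x2 b -> solves_in [set t | J t /\ t <= b] w u x1 ->
  solves_in [set t | J t /\ b <= t] w u x2 -> solves_in J w u (glue b x1 x2).
Proof.
move=> uad c1 c2 eb s1 s2.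
have cg := continuous_glue c1 c2 eb.
have g1 : solves_in [set t | J t /\ t <= b] w u (glue b x1 x2).
  by apply: (solves_in_ext (s := b) uad uad c1 cg _ _ s1) => // t [_ tb]; rewrite /glue tb.
have g2 : solves_in [set t | J t /\ b <= t] w u (glue b x1 x2).
  apply: (solves_in_ext (s := b) uad uad c2 cg _ _ s2) => // t [_ bt].
  by rewrite /glue; case: ifPn => // tb; have -> : t = b by apply/le_anti/andP.
move=> c Sc a a' aa' aJ gc j.
have [a'b|/ltW ba'] := leP a' b.
  apply: g1 => // t /andP[at_ ta']; split; first by apply: aJ; rewrite at_.
  exact: le_trans a'b.
have [ab|/ltW ba] := leP a b; last first.
  apply: g2 => // t /andP[at_ ta']; split; first by apply: aJ; rewrite at_.
  exact: le_trans at_.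
rewrite (@Rintegral_itv_cat _ _ a b a')//; last exact: rhs_integrable.
rewrite -(g1 c Sc a b)// -?(g2 c Sc b a')//; first by ring.
- move=> t /andP[h1 h2]; split => //; apply: aJ; rewrite h2 andbT.
  exact: le_trans h1.
- by move=> t /andP[h1 h2]; apply: gc; rewrite h2 andbT (le_trans ab).
- move=> t /andP[h1 h2]; split => //; apply: aJ; rewrite h1.
  exact: le_trans ba'.
- by move=> t /andP[h1 h2]; apply: gc; rewrite h1 (le_trans h2).
Qed.

Lemma phi_continuous w p u : adm u -> continuous (fun t => phi S t w p u).
Proof. by move=> uad; have [[]] := phi_solution w p uad. Qed.

Lemma phi_solves w p u : adm u -> solves_in setT w u (fun t => phi S t w p u).
Proof.
by move=> uad; have [/(solves_inT _ _ uad)[]] := phi_solution w p uad.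
Qed.

Arguments phi_continuous w p [u].
Arguments phi_solves w p [u].

Lemma phi0 w p u : adm u -> phi S 0 w p u = p.
Proof. by move=> uad; have [] := phi_solution w p uad. Qed.

Lemma admS s u : adm u -> adm (fun t => u (t + s)).
Proof. exact: admissible_shift Urange_cpt. Qed.

Lemma adm_concat s u v : adm u -> adm v -> adm (concat_control s u v).
Proof. exact: admissible_concat Urange_cpt. Qed.

Lemma continuous_shiftr x (s : R) : continuous x -> continuous (fun t => x (t + s)).
Proof.
move=> cx t; have h : (r + s) @[r --> t] --> t + s.
  by apply: cvgD; [exact: cvg_id|exact: cvg_cst].
exact: (cvg_comp _ _ h (cx (t + s))).
Qed.

(** Shifting time by [s] moves the prescribed value to time 0, where global uniqueness applies. *)
Lemma solution_phi w u x s t : adm u -> continuous x -> solves_in setT w u x ->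
  x t = phi S (t - s) (flow S s w) (x s) (fun r => u (r + s)).
Proof.
move=> uad cx xs; have usad := admS s uad.
have h : caratheodory_solution (atlas S) (flow S) (drift S) (fields S)
    (flow S s w) (fun r => u (r + s)) (fun r => x (r + s)).
  apply/solves_inT => //; split; first exact: continuous_shiftr.
  exact: (solves_in_shift uad cx xs).
have := phi_unique (x := x s) usad h; rewrite add0r => /(_ erefl (t - s)).
by rewrite subrK.
Qed.

Lemma phi_add s t w p u : adm u ->
  phi S (t + s) w p u = phi S t (flow S s w) (phi S s w p u) (fun r => u (r + s)).
Proof.
move=> uad.
have := solution_phi s (t + s) uad (phi_continuous w p uad) (phi_solves w p uad).
by rewrite addrK.
Qed.

(** The trajectory of [u] over [w] that passes through [p] at time [b] instead of time 0. *)
Definition restart b w p u t := phi S (t - b) (flow S b w) p (fun r => u (r + b)).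

Lemma restart_solution b w p u : adm u ->
  [/\ continuous (restart b w p u), solves_in setT w u (restart b w p u) &
      restart b w p u b = p].
Proof.
move=> uad; have uad' := admS b uad; split.
- move=> t; have := continuous_shiftr (s := - b) (phi_continuous (flow S b w) p uad').
  exact.
- have := solves_in_shift (s := - b) uad' (phi_continuous (flow S b w) p uad')
    (phi_solves (flow S b w) p uad').
  rewrite -flowD addNr flow0.
  have -> : (fun t => u (t - b + b)) = u by apply/funext => t; rewrite subrK.
  exact.
- by rewrite /restart subrr phi0.
Qed.

(** A solution on [[a, b]] is prolonged on both sides by the trajectories restarted at its ends,
    which makes it a global solution. *)
Lemma solves_in_itv_unique a b w u x y s : adm u -> continuous x ->
  continuous y -> solves_in [set t | a <= t <= b] w u x ->
  solves_in setT w u y -> a <= s <= b -> x s = y s ->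
  forall t, a <= t <= b -> x t = y t.
Proof.
move=> uad cx cy xs ys sab xys t tab.
have [r1c r1s r1b] := restart_solution b w (x b) uad.
have [r2c r2s r2a] := restart_solution a w (x a) uad.
pose x1 := glue b x (restart b w (x b) u).
pose x2 := glue a (restart a w (x a) u) x1.
have ab : a <= b by case/andP: sab => h1 h2; exact: le_trans h2.
have x1E r : r <= b -> x1 r = x r by rewrite /x1 /glue => ->.
have x1s : solves_in [set r | a <= r] w u x1.
  apply: solves_in_glue => //.
    by apply: solves_inS xs => r /= [-> ->].
  exact: solves_inTS.
have x1c : continuous x1 by apply: continuous_glue.
have x2E r : a <= r <= b -> x2 r = x r.
  move=> /andP[ar rb]; rewrite /x2 /glue; case: ifPn => [ra|_]; last exact: x1E.
  by have -> : r = a by apply/le_anti/andP.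
have x2c : continuous x2 by apply: continuous_glue => //; rewrite x1E// r2a.
have x2s : solves_in setT w u x2.
  apply: solves_in_glue => //; first by rewrite x1E// r2a.
    exact: solves_inTS.
  by apply: solves_inS x1s => r [].
rewrite -x2E// (solution_phi s t uad x2c x2s) x2E// xys.
by rewrite (solution_phi s t uad cy ys).
Qed.

(** The first trajectory glued at [b] to the restarted second one solves the equation of the
    concatenated control. As [0 <= b], its value at time 0 comes from the first piece, and
    uniqueness applies. *)
Lemma phi_concat b w p u v : adm u -> adm v -> 0 <= b ->
  let uv := concat_control b u v in
  (forall t, t <= b -> phi S t w p uv = phi S t w p u) /\
  (forall t, b <= t ->
     phi S t w p uv = phi S (t - b) (flow S b w) (phi S b w p u) v).
Proof.
move=> uad vad b0 uv.
have uvad : adm uv by exact: adm_concat.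
pose x1 t := phi S t w p u.
have v'ad : adm (fun t => v (t - b)) by exact: (admS (- b)).
have [rc rs rb] := restart_solution b w (x1 b) v'ad.
set r := restart _ _ _ _ in rc rs rb.
have rE t : r t = phi S (t - b) (flow S b w) (phi S b w p u) v.
  by rewrite /r /restart; congr (phi S _ _ _ _); apply/funext => s; rewrite addrK.
have x1c : continuous x1 by exact: phi_continuous.
pose x := glue b x1 r.
have xs : solves_in setT w uv x.
  apply: solves_in_glue => //.
    apply: (solves_in_ext (s := b) uad uvad x1c x1c _ _ (solves_inTS (phi_solves w p uad))) => //.
    by move=> t [_ /= tb] _; rewrite /uv /concat_control tb.
  apply: (solves_in_ext (s := b) v'ad uvad rc rc _ _ (solves_inTS rs)) => //.
  move=> t [_ /= bt] tb; rewrite /uv /concat_control leNgt lt_neqAle bt andbT.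
  by rewrite eq_sym tb.
have xc : continuous x by apply: continuous_glue.
have xE t : x t = phi S t w p uv.
  apply: phi_unique => //; first exact/solves_inT.
  by rewrite /x /glue b0 /x1 phi0.
split=> t tb; rewrite -xE /x /glue; first by rewrite tb.
case: ifPn => [tb'|_]; last exact: rE.
have -> : t = b by apply/le_anti/andP.
by rewrite subrr phi0.
Qed.

End solutions.

(** Continuous induction: [P] holds at the supremum of the good [r] by the closedness hypothesis,
    and below [h] the openness hypothesis would produce a larger one. *)
Lemma segment_induction (R : realType) (h : R) (P : R -> Prop) :
  0 <= h -> P 0 -> (forall r r', r' <= r -> P r -> P r') ->
  (forall r, 0 <= r < h -> P r -> exists2 r', r < r' & P r') ->
  (forall r, 0 < r <= h -> (forall r', 0 <= r' < r -> P r') -> P r) -> P h.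
Proof.
move=> h0 P0 Pdown Popen Pclosed.
pose A := [set r | 0 <= r <= h /\ P r].
have A0 : A 0 by split => //; rewrite lexx.
have Aub : ubound A h by move=> r [/andP[]].
have Asup : has_sup A by split; [exists 0|exists h].
have s0 : 0 <= sup A by apply: ub_le_sup => //; exists h.
have sh : sup A <= h by apply: ge_sup => //; exists 0.
have Ps : P (sup A).
  move: s0; rewrite le_eqVlt => /predU1P[<-//|s0].
  apply: Pclosed; first by rewrite s0.
  move=> r /andP[r0 rs].
  have [] := @sup_adherent R A (sup A - r) _ Asup; first by rewrite subr_gt0.
  by move=> e [_ Pe]; rewrite subKr => /ltW re; exact: Pdown Pe.
move: sh; rewrite le_eqVlt => /predU1P[<-//|sh].
have [|r sr Pr] := Popen (sup A) _ Ps; first by rewrite s0.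
have : A (Num.min r h).
  split; last by apply: Pdown Pr; rewrite ge_min lexx.
  by rewrite le_min ge_min lexx orbT h0 (le_trans s0 (ltW sr)).
move=> /(ub_le_sup (ex_intro _ h Aub)).
by rewrite leNgt lt_min sr sh.
Qed.

(** * Short-time bounds in charts, uniform in the control *)

Section charts.
Context {R : realType} {M : metricType R} {d : nat} (c : chart R M d).

Lemma near_cdom p : cdom c p -> \forall q \near p, cdom c q.
Proof. by move=> cp; exact: open_nbhs_nbhs (conj (cdom_open c) cp). Qed.

Lemma cvg_cmap (X : Type) (F : set_system X) {FF : Filter F} (P : X -> M) p j :
  cdom c p -> P z @[z --> F] --> p ->
  cmap c (P z) ord0 j @[z --> F] --> cmap c p ord0 j.
Proof.
move=> cp Pp.
have h : cmap c (P z) @[z --> F] --> cmap c p.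
  exact: (cvg_comp _ _ Pp (cmap_continuous cp)).
exact: (cvg_comp _ _ h (@coord_continuous _ _ _ ord0 j _)).
Qed.

Lemma cvg_of_coords (X : Type) (F : set_system X) {FF : Filter F} (P : X -> M) p :
  cdom c p -> (\forall z \near F, cdom c (P z)) ->
  (forall j, cmap c (P z) ord0 j @[z --> F] --> cmap c p ord0 j) ->
  P z @[z --> F] --> p.
Proof.
move=> cp cP Pp.
have h : cmap c (P z) @[z --> F] --> cmap c p by exact: cvg_row.
have cimg : (cmap c @` cdom c) (cmap c p) by exists p.
have := cvg_comp _ _ h (cinv_continuous cimg).
rewrite cmapK//; apply: cvg_trans; apply: near_eq_cvg.
by apply: filterS cP => z cz /=; rewrite cmapK.
Qed.

End charts.

Section local_bounds.
Context {R : realType} {Omega M : metricType R} {d m : nat}.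
Variable S : control_system Omega M d m.
Local Notation mu := (@lebesgue_measure R).
Local Notation adm := (admissible (Urange S)).
Implicit Types (w : Omega) (p q : M) (u v : R -> 'rV[R]_m) (x y : R -> M).

Lemma ext_field_bound c (K : set M) l j : atlas S c -> compact K ->
  K `<=` cdom c ->
  exists B : R, forall w q, K q -> `|ext_field S l w q c ord0 j| <= B.
Proof.
move=> Sc cK Kc.
have cOK : compact ([set: Omega] `*` K).
  by apply: compact_setX => //; case: S.
pose f (z : Omega * M) : R := ext_field S l z.1 z.2 c ord0 j.
have cf : {within [set: Omega] `*` K, continuous f}.
  apply: continuous_in_subspaceT => -[w q] /set_mem [_ /= Kq].
  by apply: cvg_ext_field => //; [exact: Kc|exact: cvg_fst|exact: cvg_snd].
have /compact_bounded [B [_ fB]] := continuous_compact cf cOK.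
exists (B + 1) => w q Kq; apply: (fB (B + 1)); first by rewrite ltrDl.
by exists (w, q).
Qed.

Lemma coord_lipschitz c (K : set M) : atlas S c -> compact K -> K `<=` cdom c ->
  exists2 L : R, 0 <= L & forall w u x a b, adm u -> continuous x ->
    solves_in S setT w u x -> a <= b -> (forall t, a <= t <= b -> K (x t)) ->
    forall j, `|cmap c (x b) ord0 j - cmap c (x a) ord0 j| <= L * (b - a).
Proof.
move=> Sc cK Kc.
have [B hB] := choice (fun lj : 'I_m.+1 * 'I_d =>
  ext_field_bound lj.1 lj.2 Sc cK Kc).
have [C C0 uC] := ext_control_bound S.
(* The sum over all [j] makes one constant serve every coordinate; the absolute value is there
   because nothing gives the sign of [B]. *)
pose L := \sum_(l < m.+1) \sum_(j < d) C * `|B (l, j)|.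
have L0 : 0 <= L.
  by apply: sumr_ge0 => l _; apply: sumr_ge0 => j _; rewrite mulr_ge0.
exists L => // w u x a b uad cx xs ab xK j.
have xc t : a <= t <= b -> cdom c (x t) by move=> /xK /Kc.
rewrite (xs c Sc a b)//.
apply: Rintegral_ae_bound => //; first exact: rhs_integrable.
have : {ae mu, forall t, forall l, `|ext_control u l t| <= C}.
  by apply: filter_forall => l; exact: uC.
apply: filterS => t ut tab.
rewrite control_rhsE (le_trans (ler_norm_sum _ _ _))//.
apply: ler_sum => l _; rewrite (bigD1 j)//= normrM.
rewrite -[leLHS]addr0; apply: lerD.
  rewrite ler_pM//; apply: le_trans (ler_norm _).
  by apply: (hB (l, j)); apply: xK; move: tab; rewrite in_itv.
by apply: sumr_ge0 => k _; rewrite mulr_ge0.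
Qed.

(* Trajectories that meet [N] at time [s] stay in the compact set [K] of the
   chart [c] during [[s - h, s + h]] and are [L]-Lipschitz there, uniformly in
   the base point and the control. *)
Definition tame (c : chart R M d) (K N : set M) (h L : R) : Prop :=
  [/\ atlas S c, compact K, K `<=` cdom c, 0 <= L & forall w u x s, adm u ->
    continuous x -> solves_in S setT w u x -> N (x s) ->
    (forall t, `|t - s| <= h -> K (x t)) /\
    (forall t t' j, `|t - s| <= h -> `|t' - s| <= h ->
      `|cmap c (x t) ord0 j - cmap c (x t') ord0 j| <= L * `|t - t'|)].

(** In coordinates, a trajectory of speed at most [L] that starts within [r] of the centre cannot
    leave the ball of radius [2 * r] before it has travelled a distance [r]. *)
Lemma local_tameness p :
  exists c K N (h L : R), [/\ tame c K N h L, nbhs p N & 0 < h].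
Proof.
have [c Sc cp] := (atlas_smooth S).1 p.
set y0 := cmap c p.
have : nbhs y0 (cmap c @` cdom c).
  by apply: open_nbhs_nbhs; split; [exact: cimg_open|exists p].
move=> /nbhs_normP[r0 /= r00 r0img].
(* The closed ball of radius [2 * r] must lie in the open ball of radius [r0], which is contained in
   the chart image. *)
pose r := r0 / 3.
have r_gt0 : 0 < r by rewrite divr_gt0.
pose Kc := [set y : 'rV[R]_d | `|y0 - y| <= 2 * r].
have Kcimg : Kc `<=` cmap c @` cdom c.
  move=> y /= yK; apply: r0img; rewrite /= (le_lt_trans yK)// /r.
  by rewrite mulrA ltr_pdivrMr// mulrC ltr_pM2l// ltr_nat.
have cKc : compact Kc.
  apply: bounded_closed_compact.
    exists (`|y0| + 2 * r); split; first exact: num_real.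
    move=> B hB y /= yK; apply: le_trans (ltW hB).
    by rewrite -lerBlDl (le_trans (lerB_dist _ _))// distrC.
  exact: (@closed_closed_ball_ R 'rV[R]_d y0 (2 * r)).
pose K := cinv c @` Kc.
have cK : compact K.
  apply: continuous_compact => //; apply: continuous_in_subspaceT => y /set_mem yK.
  exact/cinv_continuous/Kcimg.
have Kdom : K `<=` cdom c.
  by move=> q [y /Kcimg[q' cq' <-] <-]; rewrite cmapK.
have Kclosed : closed K := compact_closed (@metric_hausdorff R M) cK.
pose V := [set q | cdom c q /\ `|y0 - cmap c q| < 2 * r].
have VK : V `<=` K.
  by move=> q [cq qr]; exists (cmap c q); [exact: ltW|exact: cmapK].
have Vnear q : V q -> \forall q' \near q, V q'.
  move=> [cq qr]; apply: filterI; first exact: near_cdom.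
  have : `|y0 - cmap c q'| @[q' --> q] --> `|y0 - cmap c q|.
    by apply: cvg_norm; apply: cvgB; [exact: cvg_cst|exact: cmap_continuous].
  by move/cvgr_lt; exact.
pose N := [set q | cdom c q /\ `|y0 - cmap c q| < r].
have Np : nbhs p N.
  apply: filterI; first exact: near_cdom.
  have : `|y0 - cmap c q'| @[q' --> p] --> `|y0 - cmap c p|.
    by apply: cvg_norm; apply: cvgB; [exact: cvg_cst|exact: cmap_continuous].
  by move/cvgr_lt; apply; rewrite /y0 subrr normr0.
have [L L0 xL] := coord_lipschitz Sc cK Kdom.
(* Chosen so that [L * h < r], also when [L] is 0. *)
pose h := r / (L + 1).
have L10 : 0 < L + 1 by rewrite ltr_wpDl.
have h0 : 0 < h by rewrite divr_gt0.
have Lh : L * h < r.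
  by rewrite /h mulrA ltr_pdivrMr// mulrC ltr_pM2l// ltrDl.
exists c, K, N, h, L; split => //; split => // w u x s uad cx xs Nxs.
have lip rho t t' j : (forall r', `|r' - s| <= rho -> K (x r')) ->
    `|t - s| <= rho -> `|t' - s| <= rho ->
    `|cmap c (x t) ord0 j - cmap c (x t') ord0 j| <= L * `|t - t'|.
  move=> xK; wlog tt' : t t' / t' <= t.
    move=> H ts t's; have [/H|/ltW /H] := leP t' t; first exact.
    by move=> /(_ t's ts); rewrite distrC (distrC t').
  move=> ts t's; rewrite (ger0_norm (_ : 0 <= t - t')) ?subr_ge0//.
  apply: (xL w u) => // r' /andP[h1 h2]; apply: xK.
  by move: ts t's; rewrite !ler_norml; lra.
suff hV : forall t, `|t - s| <= h -> V (x t).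
  have hK t : `|t - s| <= h -> K (x t) by move=> /hV /VK.
  by split => // t t' j; exact: lip.
(* The induction is on the half-length of the time window. The speed bound presupposes that the
   trajectory stays in [K], so it cannot be applied to the whole window at once. *)
apply: (@segment_induction R h (fun rho => forall t, `|t - s| <= rho -> V (x t))).
- exact: ltW.
- move=> t; rewrite normr_le0 subr_eq0 => /eqP ->; case: Nxs => cs sr.
  by split => //; rewrite (lt_trans sr)// mulr_natl mulr2n ltrDl.
- by move=> rho rho' le_rho H t ts; apply: H; exact: le_trans le_rho.
(* Only the two ends of the window need room, which the openness of [V] gives. *)
- move=> rho /andP[rho0 rhoh] H.
  have near_end t : `|t - s| <= rho ->
      exists2 e : R, 0 < e & forall t', `|t' - t| < e -> V (x t').
    move=> /H /Vnear Vt.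
    have /nbhs_normP[e e0 eV] : \forall t' \near t, V (x t') by exact: cx Vt.
    by exists e => // t' t't; apply: eV; rewrite /= distrC.
  have [|e1 e10 V1] := near_end (s + rho).
    by rewrite addrAC subrr add0r ger0_norm.
  have [|e2 e20 V2] := near_end (s - rho).
    by rewrite addrAC subrr add0r normrN ger0_norm.
  pose e := Num.min e1 e2.
  have e_gt0 : 0 < e by rewrite lt_min e10.
  have ee1 : e <= e1 by rewrite ge_min lexx.
  have ee2 : e <= e2 by rewrite ge_min lexx orbT.
  exists (rho + e / 2); first by rewrite ltrDl divr_gt0.
  move=> t; rewrite ler_norml => /andP[t1 t2].
  have [|] := leP `|t - s| rho; first exact: H.
  rewrite lter_normr => /orP[st|st].
    by apply: V1; rewrite ltr_norml; lra.
  by apply: V2; rewrite ltr_norml; lra.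
- move=> rho /andP[rho0 rhoh] H.
  have xK t : `|t - s| <= rho -> K (x t).
    move=> ts.
    (* Times strictly inside the window tend to [t], and [K] is closed. The Lipschitz bound then
       improves membership in [K] to membership in [V]. *)
    have : x (s + (1 - e) * (t - s)) @[e --> 0^'+] --> x t.
      apply: cvg_at_right_filter.
      have tE : s + (1 - 0) * (t - s) = t by ring.
      have h1 : s + (1 - e) * (t - s) @[e --> (0 : R)] --> t.
        rewrite -[X in _ --> X]tE; apply: cvgD; first exact: cvg_cst.
        apply: cvgM; last exact: cvg_cst.
        by apply: cvgB; [exact: cvg_cst|exact: cvg_id].
      exact: (cvg_comp _ _ h1 (cx t)).
    apply: closed_cvg => //; near=> e.
    have e0 : 0 < e by near: e; exact: nbhs_right_gt.
    have e1 : e < 1 by near: e; exact: nbhs_right_lt.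
    apply/VK/(H ((1 - e) * rho)).
      by rewrite mulr_ge0/= ?subr_ge0 ?(ltW e1) ?(ltW rho0)// gtr_pMl// gtrBl.
    rewrite addrAC subrr add0r normrM ger0_norm ?subr_ge0 ?(ltW e1)//.
    by rewrite ler_pM2l// subr_gt0.
  move=> t ts; split; first exact/Kdom/xK.
  have st : `|s - s| <= rho by rewrite subrr normr0 ltW.
  have : `|cmap c (x s) - cmap c (x t)| <= L * h.
    apply: row_norm_le; first by rewrite mulr_ge0// ltW.
    move=> j; rewrite !mxE (le_trans (lip rho s t j xK st ts))//.
    by rewrite ler_wpM2l// distrC (le_trans ts).
  move=> h1; have h2 := Nxs.2.
  rewrite (_ : y0 - _ = (y0 - cmap c (x s)) + (cmap c (x s) - cmap c (x t))).
    rewrite (le_lt_trans (ler_normD _ _))// mulr_natl mulr2n.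
    by rewrite ltrD// (le_lt_trans h1).
  by rewrite addrA subrK.
Unshelve. all: by end_near. Qed.

End local_bounds.

(** * Continuous dependence *)

Lemma clamp_continuous (R : realType) (a b : R) : continuous (clamp a b).
Proof.
move=> t; apply/cvgrPdist_le => e e0; exists e => //= s ts.
by rewrite (le_trans (clamp_lipschitz _ _ _ _))// ltW.
Qed.

Section convergence.
Context {R : realType} {Omega M : metricType R} {d m : nat}.
Variable S : control_system Omega M d m.
Local Notation mu := (@lebesgue_measure R).
Local Notation adm := (admissible (Urange S)).
Implicit Types (w : Omega) (p q : M) (u v : R -> 'rV[R]_m) (x y : R -> M).

Section ultralimit.
Context {I : Type} (F : set_system I) {UF : UltraFilter F}.
Variables (ws : I -> Omega) (us : I -> R -> 'rV[R]_m).
Variables (w : Omega) (u : R -> 'rV[R]_m).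
Hypothesis usad : forall i, adm (us i).
Hypothesis uad : adm u.
Hypothesis wsw : ws i @[i --> F] --> w.
Hypothesis weak : forall l a b, a <= b ->
  \int[mu]_(t in `[a, b]) us i t ord0 l @[i --> F] -->
  \int[mu]_(t in `[a, b]) u t ord0 l.

Let FF : ProperFilter F := ultra_proper.
#[local] Existing Instance FF.

Lemma weak_ext_control l a b : a <= b ->
  \int[mu]_(t in `[a, b]) ext_control (us i) l t @[i --> F] -->
  \int[mu]_(t in `[a, b]) ext_control u l t.
Proof.
move=> ab; rewrite /ext_control; case: unlift => [k|]; first exact: weak.
exact: cvg_cst.
Qed.

(* The limit equation holds in every chart at once, so no change of variables
   is needed to see that the limit is a solution. *)
Lemma solves_in_limit (xs : I -> R -> M) a b (z : R -> M) : continuous z ->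
  (forall i, continuous (xs i)) ->
  (\forall i \near F, solves_in S [set t | a <= t <= b] (ws i) (us i) (xs i)) ->
  (forall t, xs r.2 r.1 @[r --> filter_prod (nbhs t) F] --> z t) ->
  solves_in S [set t | a <= t <= b] w u z.
Proof.
move=> cz cxs xsS xsz c Sc a' b' ab' abJ zc j.
have [C C0 uC] := ext_control_bound S.
(* Joint convergence and compactness of the time interval put the whole arcs eventually in the
   domain of [c], where their integral equations can be used. *)
have xsc : \forall i \near F, `[a', b'] `<=` [set t | cdom c (xs i t)].
  have := @segment_compact R a' b'; rewrite compact_near_coveringP.
  apply => t /=; rewrite in_itv /= => tab.
  by have := xsz t _ (near_cdom (zc t tab)).
have pt t : xs i t @[i --> F] --> z t.
  have h : (t, i) @[i --> F] --> filter_prod (nbhs t) F.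
    move=> P [[A B] /= [At FB] AB]; apply: (@filterS _ F _ B) => // i Bi.
    by apply: (AB (t, i)); split => //; exact: nbhs_singleton.
  exact: (cvg_comp _ _ h (xsz t)).
under eq_Rintegral do rewrite control_rhsE.
apply: (@weak_limit_integral_equation R I F _ m.+1
  (fun i => ext_control (us i)) (ext_control u)
  (fun i l r => ext_field S l (flow S r (ws i)) (xs i r) c ord0 j)
  (fun l r => ext_field S l (flow S r w) (z r) c ord0 j)
  (fun i t => cmap c (xs i t) ord0 j) (fun t => cmap c (z t) ord0 j) C a' b') => //.
- by move=> i l; exact: uC.
- by move=> l; exact: uC.
- by move=> i l; apply: integrable_ext_control; exact: usad.
- by move=> l; exact: integrable_ext_control uad.
- by move=> l s t _ st _; exact: weak_ext_control.
- move=> l t tab e e0.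
  rewrite in_itv /= in tab.
  have : ext_field S l (flow S r.1 (ws r.2)) (xs r.2 r.1) c ord0 j
      @[r --> filter_prod (nbhs t) F] --> ext_field S l (flow S t w) (z t) c ord0 j.
    apply: cvg_ext_field => //; first exact: zc.
    apply: cvg_flow; first exact: cvg_fst.
    exact: (cvg_comp _ _ cvg_snd wsw).
  move/cvgrPdist_le => /(_ e e0); apply: filterS => r /= + _.
  by rewrite distrC.
- move=> t; rewrite in_itv /= => tab; apply: cvg_cmap (pt t).
  exact: zc.
- apply: filterS2 xsc xsS => i xc xS s t a's st tb'.
  have sub r : s <= r <= t -> a' <= r <= b'.
    by move=> /andP[sr rt]; rewrite (le_trans a's)// (le_trans rt).
  have xcst r : s <= r <= t -> cdom c (xs i r).
    by move=> /sub rab; apply: xc; rewrite /= in_itv.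
  have eqf : (fun r => \sum_l ext_control (us i) l r *
      ext_field S l (flow S r (ws i)) (xs i r) c ord0 j) =
      (fun r => control_rhs (flow S) (drift S) (fields S) (ws i) (us i) r
        (xs i r) c ord0 j) by apply/funext => r; rewrite control_rhsE.
  rewrite eqf; split; first exact: rhs_integrable.
  by apply: xS => // r /sub; exact: abJ.
- have -> : (fun r => \sum_l ext_control u l r *
      ext_field S l (flow S r w) (z r) c ord0 j) =
      (fun r => control_rhs (flow S) (drift S) (fields S) w u r (z r) c ord0 j).
    by apply/funext => r; rewrite control_rhsE.
  exact: rhs_integrable.
Qed.

(** An Arzela-Ascoli argument along an ultrafilter: the trajectories have pointwise limits in [K],
    the common Lipschitz bound makes the convergence joint in time and index, and uniqueness
    identifies the limit with [y]. *)
Lemma window_convergence (xs : I -> R -> M) (y : R -> M) c K N h L s :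
  tame S c K N h L -> 0 < h -> nbhs (y s) N ->
  (forall i, continuous (xs i)) ->
  (forall i, solves_in S setT (ws i) (us i) (xs i)) ->
  continuous y -> solves_in S setT w u y -> xs i s @[i --> F] --> y s ->
  forall t, `|t - s| < h -> xs r.2 r.1 @[r --> filter_prod (nbhs t) F] --> y t.
Proof.
move=> [Sc cK Kc L0 tK] h0 Ns cxs xsS cy yS xsy.
(* Freezing the trajectories outside the window makes the bounds of [tame] valid at all times. *)
pose cl := clamp (s - h) (s + h).
have sh : s - h <= s + h by lra.
have cls t : `|cl t - s| <= h.
  by have := clamp_itv t sh; rewrite in_itv /= ler_distl => /andP[-> ->].
have clE t : `|t - s| <= h -> cl t = t.
  by rewrite ler_distl => tsh; exact: clamp_id.
pose X i t := xs i (cl t).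
have good : \forall i \near F, (forall t, K (X i t)) /\ forall t t' j,
    `|cmap c (X i t) ord0 j - cmap c (X i t') ord0 j| <= L * `|t - t'|.
  have xsN : \forall i \near F, N (xs i s) by exact: xsy.
  apply: filterS xsN => i Nxi.
  have [xK xL] := tK _ _ _ _ (usad i) (cxs i) (xsS i) Nxi.
  split=> [t|t t' j]; first exact: xK.
  by rewrite (le_trans (xL _ _ j (cls t) (cls t')))// ler_wpM2l// clamp_lipschitz.
have [z zP] := choice (fun t => ultra_compact_cvg (f := X ^~ t) cK
  (filterS (fun i (H : _ /\ _) => H.1 t) good)).
have zK t : K (z t) := (zP t).1.
have zc t : cdom c (z t) := Kc _ (zK t).
have Xz t : X i t @[i --> F] --> z t := (zP t).2.
have zL t t' j : `|cmap c (z t) ord0 j - cmap c (z t') ord0 j| <= L * `|t - t'|.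
  apply: (@cvg_norm_le _ I F _
    (fun i => cmap c (X i t) ord0 j - cmap c (X i t') ord0 j)).
    by apply: cvgB; apply: cvg_cmap.
  by apply: filterS good => i [_]; exact.
have small (t e : R) : 0 < e -> \forall t' \near t, L * `|t' - t| <= e.
  move=> e0; near=> t'.
  rewrite (@le_trans _ _ (L * (e / (L + 1))))//.
    rewrite ler_wpM2l// distrC; near: t'.
    by apply: (@cvgr_dist_le _ _ _ _ _ id) => //; rewrite divr_gt0// ltr_wpDl.
  by rewrite mulrCA ger_pMr// ler_pdivrMr ?ltr_wpDl// mul1r lerDl.
have cz : continuous z.
  move=> t; apply: (cvg_of_coords (c := c)) => //.
    by apply: filterE => r; exact: zc.
  move=> j; apply/cvgrPdist_le => e e0; apply: filterS (small t e e0) => t'.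
  by apply: le_trans; rewrite distrC zL.
have Xjoint t : X r.2 r.1 @[r --> filter_prod (nbhs t) F] --> z t.
  apply: (cvg_of_coords (c := c)) => //.
    have : \forall r \near filter_prod (nbhs t) F, forall t', K (X r.2 t').
      exists (setT, [set i | forall t', K (X i t')]); last by move=> r [].
    split => /=; first exact: filterT.
    by apply: filterS good => i [].
    by apply: filterS => r rK; exact/Kc/rK.
  move=> j; apply/cvgrPdist_le => e e0.
  have e20 : 0 < e / 2 by rewrite divr_gt0.
  have h1 : \forall i \near F, `|cmap c (z t) ord0 j - cmap c (X i t) ord0 j| <= e / 2.
    have : cmap c (X i t) ord0 j @[i --> F] --> cmap c (z t) ord0 j.
      exact: cvg_cmap.
    by move/cvgrPdist_le; exact.
  exists ([set t' | L * `|t' - t| <= e / 2], [set i |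
    `|cmap c (z t) ord0 j - cmap c (X i t) ord0 j| <= e / 2 /\
    forall t t' j, `|cmap c (X i t) ord0 j - cmap c (X i t') ord0 j| <= L * `|t - t'|]).
    split => /=; first exact: small.
    by apply: filterS2 h1 good => i ? [_ ?].
  move=> [t' i] /= [t't [zX lip]].
  rewrite (_ : _ - _ = (cmap c (z t) ord0 j - cmap c (X i t) ord0 j) +
    (cmap c (X i t) ord0 j - cmap c (X i t') ord0 j)); last by ring.
  rewrite (le_trans (ler_normD _ _))// [leRHS]splitr lerD// distrC.
  exact: le_trans t't.
have zS : solves_in S [set t | s - h <= t <= s + h] w u z.
  have cX i : continuous (X i).
    by move=> t; exact: (cvg_comp _ _ (clamp_continuous (x := t)) (cxs i (cl t))).
  apply: (solves_in_limit cz cX _ Xjoint); apply: filterE => i.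
  apply: (solves_in_ext (s := s) (usad i) (usad i) (cxs i) (cX i)).
  - by move=> t /= tsh; rewrite /X clE// ler_distl.
  - by [].
  - exact: solves_inTS.
have zsE : z s = y s.
  have ss : `|s - s| <= h by rewrite subrr normr0 ltW.
  have Xs := Xz s; rewrite /X /= (clE s ss) in Xs.
  exact: (cvg_unique (@metric_hausdorff R M) Xs xsy).
have zyE : forall t, `|t - s| <= h -> z t = y t.
  move=> t; rewrite ler_distl; apply: (solves_in_itv_unique uad cz cy zS yS _ zsE).
  by rewrite lerDl gerBl ltW.
move=> t ts; rewrite -(zyE t (ltW ts)).
apply: cvg_trans (Xjoint t); apply: near_eq_cvg.
have : \forall t' \near t, `|t' - s| <= h.
  have : `|t' - s| @[t' --> t] --> `|t - s|.
    by apply: cvg_norm; apply: cvgB; [exact: cvg_id|exact: cvg_cst].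
  by move/cvgr_le; exact.
move=> ht; exists ([set t' | `|t' - s| <= h], setT).
  by split => //; exact: filterT.
by move=> r [/= rs _]; rewrite /X clE.
Unshelve. all: by end_near. Qed.

(* The set of times at which the trajectories converge is open and closed. *)
Lemma phi_weak_convergence (ps : I -> M) p : ps i @[i --> F] --> p ->
  forall t, phi S r.1 (ws r.2) (ps r.2) (us r.2) @[r --> filter_prod (nbhs t) F]
    --> phi S t w p u.
Proof.
move=> psp.
pose y t := phi S t w p u.
pose xs i t := phi S t (ws i) (ps i) (us i).
have window t0 : exists2 e : R, 0 < e & forall s, `|s - t0| < e ->
    xs i s @[i --> F] --> y s -> forall t, `|t - t0| < e ->
    xs r.2 r.1 @[r --> filter_prod (nbhs t) F] --> y t.
  have [c [K [N [h [L [tameN Ny h0]]]]]] := local_tameness S (y t0).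
  have [e0 /= e00 e0N] : exists2 e : R, 0 < e & forall s, `|s - t0| < e -> nbhs (y s) N.
    have yN : \forall s \near t0, nbhs (y s) N.
      have cy : y s @[s --> t0] --> y t0 by exact: phi_continuous.
      exact: cy _ (nbhs_interior Ny).
    have /nbhs_normP[e e_gt0 eN] := yN; exists e => // s st.
    by apply: eN; rewrite /= distrC.
  (* With [s] and [t] both within [h / 2] of [t0], they are less than [h] apart. *)
  exists (Num.min e0 (h / 2)); first by rewrite lt_min e00 divr_gt0.
  move=> s; rewrite lt_min => /andP[se0 sh] xsy t; rewrite lt_min => /andP[_ th].
  apply: (window_convergence tameN h0 (e0N s se0)) => //.
  - by move=> i; exact: phi_continuous.
  - by move=> i; exact: phi_solves.
  - exact: phi_continuous.
  - exact: phi_solves.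
  - by move: sh th; rewrite !ltr_norml; lra.
pose G := [set t | xs i t @[i --> F] --> y t].
have point t : xs r.2 r.1 @[r --> filter_prod (nbhs t) F] --> y t -> G t.
  move=> xy; have h : (t, i) @[i --> F] --> filter_prod (nbhs t) F.
    move=> P [[A B] /= [At FB] AB]; apply: (@filterS _ F _ B) => // i Bi.
    by apply: (AB (t, i)); split => //; exact: nbhs_singleton.
  exact: (cvg_comp _ _ h xy).
have near_ball (t e : R) : 0 < e -> \forall s \near t, `|s - t| < e.
  by move=> e0; exists e => // s /=; rewrite distrC.
have Gopen : open G.
  rewrite openE => t Gt; have [e e0 eG] := window t.
  apply: filterS (near_ball t e e0) => s st; apply: point.
  by apply: (eG t) => //; rewrite subrr normr0.
have Gclosed : closed G.
  (* The radius of [window] serves all [s] near [t], so a good time close to [t] has [t] in its own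
     window. *)
  move=> t clGt; have [e e0 eG] := window t.
  have [s [Gs st]] := clGt _ (near_ball t e e0).
  by apply/point/(eG s) => //; rewrite subrr normr0.
have GT : G = setT.
  have cT : connected [set: R] by apply/connected_intervalP.
  apply: cT; [|by exists G => //; rewrite setTI|by exists G => //; rewrite setTI].
  exists 0; rewrite /G /= /xs /y phi0//.
  by under eq_cvg do rewrite phi0//.
move=> t; have [e e0 eG] := window t.
apply: (eG t); [by rewrite subrr normr0| |by rewrite subrr normr0].
by have : G t by rewrite GT.
Qed.

Lemma phi_weak_convergence_pt (ps : I -> M) p (ts : I -> R) t :
  ps i @[i --> F] --> p -> ts i @[i --> F] --> t ->
  phi S (ts i) (ws i) (ps i) (us i) @[i --> F] --> phi S t w p u.
Proof.
move=> psp tst.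
have h : (ts i, i) @[i --> F] --> filter_prod (nbhs t) F.
  exact: (cvg_pair tst cvg_id).
exact: (cvg_comp _ _ h (phi_weak_convergence psp (t := t))).
Qed.

End ultralimit.

(** A filter is the intersection of the ultrafilters that refine it; this brings back ordinary
    limits from those along ultrafilters. *)
Lemma cvg_ultra (T : Type) (V : topologicalType) (H : set_system T)
    {FH : ProperFilter H} (f : T -> V) (l : V) :
  (forall G : set_system T, UltraFilter G -> H `<=` G -> f @ G --> l) ->
  f @ H --> l.
Proof.
move=> fG A lA; apply: contrapT => nHA.
have PW : ProperFilter (within (~` (f @^-1` A)) H).
  split; last exact: within_filter.
  move=> h0; apply: nHA; apply: (@filterS _ H _ _ _ _ h0) => x h.
  by apply: contrapT => /h.
have [G [UG HG]] := ultraFilterLemma PW.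
have sub : H `<=` G by move=> B HB; apply: HG; apply: filterS HB => x Bx _.
have GA := fG G UG sub A lA.
have GnA : G (~` (f @^-1` A)) by apply: HG; exact: withinT.
have : G set0 by rewrite -(setICr (f @^-1` A)); exact: filterI.
exact: filter_not_empty.
Qed.

(** A constant family of controls converges weakly to its value. *)
Lemma continuous_phi u : adm u ->
  continuous (fun z : R * (Omega * M) => phi S z.1 z.2.1 z.2.2 u).
Proof.
move=> uad [t [w p]]; apply: cvg_ultra => G UG zG.
have PG : ProperFilter G by exact: ultra_proper.
have z1 : z.1 @[z --> G] --> t by exact: (cvg_trans (cvg_fmap2 zG) cvg_fst).
have z2 : z.2 @[z --> G] --> (w, p) by exact: (cvg_trans (cvg_fmap2 zG) cvg_snd).
have z21 : z.2.1 @[z --> G] --> w by exact: (cvg_comp _ _ z2 cvg_fst).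
have z22 : z.2.2 @[z --> G] --> p by exact: (cvg_comp _ _ z2 cvg_snd).
apply: (@phi_weak_convergence_pt _ G UG (fun z => z.2.1) (fun=> u) w u) => //.
by move=> l a b ab; exact: cvg_cst.
Qed.

(* Continuity in the initial point is uniform in the control because the set of
   controls is weakly compact. *)
Lemma phi_equicontinuous w p (T e : R) : 0 <= T -> 0 < e ->
  exists2 delta : R, 0 < delta & forall q u s, mdist p q < delta -> adm u ->
    0 <= s <= T -> mdist (phi S s w p u) (phi S s w q u) < e.
Proof.
move=> T0 e0; apply: contrapT => nH.
have /choice[f fP] n : exists z : M * ((R -> 'rV[R]_m) * R),
    [/\ mdist p z.1 < n.+1%:R^-1, adm z.2.1, 0 <= z.2.2 <= T &
        e <= mdist (phi S z.2.2 w p z.2.1) (phi S z.2.2 w z.1 z.2.1)].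
  apply: contrapT => nz; apply: nH; exists n.+1%:R^-1; first by rewrite invr_gt0.
  move=> q u s pq uad sT; rewrite ltNge; apply/negP => h; apply: nz.
  by exists (q, (u, s)).
have [F [UF sF]] := ultraFilterLemma (eventually_filter : ProperFilter \oo).
have PF : ProperFilter F by exact: ultra_proper.
have fad n : adm (f n).2.1 by have [] := fP n.
have cU : compact (Urange S) by exact: Urange_cpt.
have vU : convex_set (Urange S) by exact: Urange_convex.
have [u uad weak] := weak_compactness (F := F) cU vU fad.
have [|s [_ fs]] := ultra_compact_cvg (F := F) (f := fun n => (f n).2.2)
    (@segment_compact R 0 T).
  by apply: filterE => n /=; rewrite in_itv; have [] := fP n.
have fq : (f n).1 @[n --> F] --> p.
  have h : (f n).1 @[n --> \oo] --> p.
    apply/metricType_numDomainType.cvgrPdist_lt => r r0.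
    near=> n; have [h _ _ _] := fP n; apply: lt_trans h _.
    near: n; exact: (near_infty_natSinv_lt (PosNum r0)).
  exact: (cvg_trans (cvg_fmap2 sF) h).
have pp : p @[_ --> F] --> p by exact: cvg_cst.
have wcst : w @[_ --> F] --> w by exact: cvg_cst.
(* Both end points tend to [phi S s w p u], although they stay at distance at least [e]. *)
have c1 := @phi_weak_convergence_pt _ F UF (fun=> w) (fun n => (f n).2.1) w u
  fad uad wcst weak _ p _ s pp fs.
have c2 := @phi_weak_convergence_pt _ F UF (fun=> w) (fun n => (f n).2.1) w u
  fad uad wcst weak _ p _ s fq fs.
have e20 : 0 < e / 2 by rewrite divr_gt0.
have n1 := metricType_numDomainType.cvgr_dist_lt c1 e20.
have n2 := metricType_numDomainType.cvgr_dist_lt c2 e20.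
have [n [h1 h2]] := filter_ex (filterI (n1 _) (n2 _)).
have [_ _ _] := fP n; apply/negP; rewrite -ltNge.
rewrite (le_lt_trans (metric_triangle _ (phi S s w p u) _))// [ltRHS]splitr.
by rewrite ltrD// metric_sym.
Unshelve. all: by end_near. Qed.

End convergence.

(** * Chains *)

Section chains.
Context {R : realType} {Omega M : metricType R} {d m : nat}.
Variable S : control_system Omega M d m.
Local Notation mu := (@lebesgue_measure R).
Local Notation adm := (admissible (Urange S)).
Implicit Types (w : Omega) (x : M) (p q r : Omega * M) (u v : R -> 'rV[R]_m).

Definition step (e T : R) p q : Prop := exists u t,
  [/\ adm u, T <= t <= 2 * T, flow S t p.1 = q.1 &
      mdist (phi S t p.1 p.2 u) q.2 < e].

(* [reach e T p q]: an (e, T)-chain from [p] whose last point is exactly [q]. *)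
Inductive reach (e T : R) : Omega * M -> Omega * M -> Prop :=
| reach_step p q : step e T p q -> reach e T p q
| reach_cons p q r : step e T p q -> reach e T q r -> reach e T p r.

Lemma reach_trans e T p q r : reach e T p q -> reach e T q r -> reach e T p r.
Proof.
move=> pq; elim: pq r => [p1 q1 s r qr|p1 q1 r1 s _ IH r rr].
  exact: reach_cons qr.
exact: reach_cons s (IH _ rr).
Qed.

(** A long trajectory is cut into pieces of length [T] with zero jumps until the rest has length in
    [[T, 2 * T]]. *)
Lemma reach_long e T w x y u t : 0 < T -> adm u -> T <= t ->
  mdist (phi S t w x u) y < e -> reach e T (w, x) (flow S t w, y).
Proof.
move=> T0 uad Tt.
have [n tn] : exists n : nat, t <= n.+1%:R * T.
  exists (Num.bound (t / T)); rewrite -ler_pdivrMr//.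
  rewrite (le_trans (ltW (archi_boundP _)))// ?ler_nat//.
  by rewrite divr_ge0 ?ltW// (lt_le_trans T0).
elim: n t Tt tn w x u uad => [|n IH] t Tt tn w x u uad xy.
  apply: reach_step; exists u, t; split => //=.
  by rewrite Tt (le_trans tn)// mul1r ler_peMl ?ler1n// ltW.
have [t2|/ltW t2] := leP t (2 * T).
  by apply: reach_step; exists u, t; split => //=; rewrite Tt.
have tE : t = (t - T) + T by rewrite subrK.
apply: (@reach_cons _ _ _ (flow S T w, phi S T w x u)).
  exists u, T; split => //=; last by rewrite mdistxx (le_lt_trans _ xy)// mdist_ge0.
  by rewrite lexx ler_peMl ?ler1n// ltW.
rewrite tE flowD; apply: (IH (t - T) _ _ _ _ (fun s => u (s + T))).
- by rewrite lerBrDr; lra.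
- by rewrite lerBlDr (le_trans tn)// -[n.+2]addn1 natrD mulrDl mul1r.
- exact: admS.
- by rewrite -phi_add// -tE.
Qed.

(** Lowering [T'] to [T] also lowers the upper bound on the jump times, so each segment has to be
    cut again. *)
Lemma reach_weaken e e' T T' p q : 0 < T -> T <= T' -> e' <= e ->
  reach e' T' p q -> reach e T p q.
Proof.
move=> T0 TT ee.
have H p1 q1 : step e' T' p1 q1 -> reach e T p1 q1.
  case: p1 q1 => w x [w' x'] [u [t [uad /andP[Tt _] /= <- xx']]].
  by apply: (reach_long T0 uad); [exact: le_trans Tt|exact: lt_le_trans ee].
elim=> [p1 q1 s|p1 q1 r1 s _ IH]; first exact: H.
exact: reach_trans (H _ _ s) IH.
Qed.

Lemma reach_first e T p r : reach e T p r ->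
  exists q, step e T p q /\ (q = r \/ reach e T q r).
Proof.
case=> [p1 q1 s|p1 q1 r1 s qr]; first by exists q1; split => //; left.
by exists q1; split => //; right.
Qed.

Lemma reach_last e T p r : reach e T p r ->
  exists q, (p = q \/ reach e T p q) /\ step e T q r.
Proof.
elim=> [p1 q1 s|p1 q1 r1 s _ [q [[<-|pq] qr]]].
- by exists p1; split => //; left.
- by exists q1; split => //; right; exact: reach_step.
- by exists q; split => //; right; exact: reach_cons pq.
Qed.

Lemma chain_reach e T p q n ws xs us Ts T0 i j :
  controlled_chain S e T p q n ws xs us Ts -> 0 < T0 -> T0 <= T ->
  (i < j <= n)%N -> reach e T0 (ws i, xs i) (ws j, xs j).
Proof.
move=> C T00 T0T.
have one k : (k < n)%N -> reach e T0 (ws k, xs k) (ws k.+1, xs k.+1).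
  move=> kn; rewrite -(chain_base C kn).
  apply: (reach_long T00 (chain_controls C kn)).
    by have /andP[h _] := chain_times C kn; exact: le_trans h.
  exact: (chain_jumps C).
elim: j => // j IH /andP[]; rewrite ltnS leq_eqVlt => /predU1P[->|ij] jn.
  exact: one.
by apply: reach_trans (one j jn); apply: IH; rewrite ij ltnW.
Qed.

Lemma reach_chain e T p p' q : reach e T p p' -> p'.2 = q.2 ->
  mdist p'.1 q.1 < e ->
  exists n ws xs us Ts, controlled_chain S e T p q n ws xs us Ts.
Proof.
move=> pp'; elim: pp' q => [p1 q1 [u [t [uad tT fq xq]]]|
    p1 q1 r1 [u [t [uad tT fq xq]]] _ IH] q eq2 eq1.
  exists 1%N, (fun j => if j is 0%N then p1.1 else q1.1),
    (fun j => if j is 0%N then p1.2 else q1.2), (fun=> u), (fun=> t).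
  split => //; first by case: (p1).
  - by case.
  - by case.
have [n [ws [xs [us [Ts C]]]]] := IH q eq2 eq1.
exists n.+1, (fun j => if j is j'.+1 then ws j' else p1.1),
  (fun j => if j is j'.+1 then xs j' else p1.2),
  (fun j => if j is j'.+1 then us j' else u),
  (fun j => if j is j'.+1 then Ts j' else t).
have [ws0 xs0] : ws 0%N = q1.1 /\ xs 0%N = q1.2.
  by split; [exact: (congr1 fst (chain_start C))|exact: (congr1 snd (chain_start C))].
split => //.
- by case: (p1).
- exact: chain_end C.
- by case=> // j jn; exact: (chain_controls C).
- by case=> // j jn; exact: (chain_times C).
- by case=> [|j] jn; [rewrite ws0|exact: (chain_base C)].
- exact: chain_base_end C.
- by case=> [|j] jn; [rewrite xs0|exact: (chain_jumps C)].
Qed.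

Lemma chains_betweenP p q : chains_between S p q <->
  forall e T : R, 0 < e -> 0 < T ->
    exists2 w, reach e T p (w, q.2) & mdist w q.1 < e.
Proof.
split=> H e T e0 T0.
  have [n [ws [xs [us [Ts C]]]]] := H e T e0 T0.
  exists (ws n); last exact: chain_base_end C.
  have := chain_reach (i := 0) (j := n) C T0 (lexx T).
  rewrite (chain_start C) (chain_end C) leqnn (chain_pos C); exact.
by have [w pw wq] := H e T e0 T0; exact: reach_chain pw _ wq.
Qed.

Lemma near_mdist (X : metricType R) (a : X) (P : set X) :
  (\forall z \near a, P z) ->
  exists2 delta : R, 0 < delta & forall z, mdist a z < delta -> P z.
Proof.
move=> /nbhs_ballP[delta /= delta0 aP]; exists delta => // z az.
by apply: aP; rewrite ballEmdist.
Qed.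

Lemma cvg_phi_flow u t w x : adm u ->
  phi S t z.1 z.2 u @[z --> (w, x)] --> phi S t w x u /\
  flow S t z.1 @[z --> (w, x)] --> flow S t w.
Proof.
move=> uad.
have h1 : z.1 @[z --> (w, x)] --> w by exact: cvg_fst.
have h2 : z.2 @[z --> (w, x)] --> x by exact: cvg_snd.
have ht : t @[_ --> (w, x)] --> t by exact: cvg_cst.
split; last exact: cvg_flow.
have h : (t, (z.1, z.2)) @[z --> (w, x)] --> (t, (w, x)).
  exact: (cvg_pair ht (cvg_pair h1 h2)).
exact: (cvg_comp _ _ h (continuous_phi uad (x := (t, (w, x))))).
Qed.

Lemma near_phi_flow u t w x (e : R) : adm u -> 0 < e ->
  exists2 delta : R, 0 < delta & forall w' x', mdist w w' < delta ->
    mdist x x' < delta ->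
    mdist (flow S t w) (flow S t w') < e /\
    mdist (phi S t w x u) (phi S t w' x' u) < e.
Proof.
move=> uad e0; have [h1 h2] := cvg_phi_flow t w x uad.
have n1 := metricType_numDomainType.cvgr_dist_lt h1 e0.
have n2 := metricType_numDomainType.cvgr_dist_lt h2 e0.
have [[A B] /= [Aw Bx] AB] := filterI (n1 _) (n2 _).
have [a a0 aA] := near_mdist Aw; have [b b0 bB] := near_mdist Bx.
exists (Num.min a b); first by rewrite lt_min a0.
move=> w' x'; rewrite !lt_min => /andP[wa _] /andP[_ xb].
have [k1 k2] : _ := AB (w', x') (conj (aA _ wa) (bB _ xb)).
by split.
Qed.

(** Controls, times and jump points are kept and only the base moves. The jump inequalities are
    strict and finitely many, so they survive; the tolerance for the tail of the chain is the
    precision required of its first step. *)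
Lemma reach_perturb e T p q : reach e T p q -> forall eta : R, 0 < eta ->
  exists2 delta : R, 0 < delta & forall w, mdist p.1 w < delta ->
    exists2 w', mdist q.1 w' < eta & reach e T (w, p.2) (w', q.2).
Proof.
have H p1 q1 : step e T p1 q1 -> forall eta : R, 0 < eta ->
    exists2 delta : R, 0 < delta & forall w, mdist p1.1 w < delta ->
      exists2 w', mdist q1.1 w' < eta & step e T (w, p1.2) (w', q1.2).
  move=> [u [t [uad tT fq xq]]] eta eta0.
  have gap : 0 < e - mdist (phi S t p1.1 p1.2 u) q1.2 by rewrite subr_gt0.
  have [d1 d10 h1] := near_phi_flow t p1.1 p1.2 uad gap.
  have [d2 d20 h2] := near_phi_flow t p1.1 p1.2 uad eta0.
  exists (Num.min d1 d2); first by rewrite lt_min d10.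
  move=> w; rewrite lt_min => /andP[wd1 wd2].
  have xx (a : R) : 0 < a -> mdist p1.2 p1.2 < a by rewrite mdistxx.
  exists (flow S t w); first by rewrite -fq; exact: (h2 _ _ wd2 (xx _ d20)).1.
  exists u, t; split => //=.
  have := (h1 _ _ wd1 (xx _ d10)).2; rewrite ltrBrDr => lt_e.
  apply: le_lt_trans lt_e; rewrite [X in _ <= X + _]metric_sym.
  exact: metric_triangle.
elim=> [p1 q1 s|p1 q1 r1 s _ IH] eta eta0.
  have [delta d0 hd] := H _ _ s eta eta0; exists delta => // w /hd[w' h1 h2].
  by exists w' => //; exact: reach_step.
have [delta d0 hd] := IH eta eta0.
have [delta' d0' hd'] := H _ _ s delta d0.
exists delta' => // w /hd'[w1 /hd[w2 h1 h2] s1].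
by exists w2 => //; exact: reach_cons s1 h2.
Qed.

Lemma chains_between_trans p q r :
  chains_between S p q -> chains_between S q r -> chains_between S p r.
Proof.
move=> /chains_betweenP pq /chains_betweenP qr; apply/chains_betweenP => e T e0 T0.
have [w2 q2 w2r] := qr e T e0 T0.
have gap : 0 < e - mdist w2 r.1 by rewrite subr_gt0.
have [delta d0 hd] := reach_perturb q2 gap.
(* The second chain is fixed first: the slack in its final base error determines [delta], hence the
   precision of the first chain. *)
have m0 : 0 < Num.min e delta by rewrite lt_min e0.
have [w1 p1 w1q] := pq _ T m0 T0.
have [|w3 w32 w13] := hd w1.
  by rewrite metric_sym (lt_le_trans w1q)// ge_min lexx orbT.
exists w3.
  apply: reach_trans w13; apply: reach_weaken p1 => //.
  by rewrite ge_min lexx.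
rewrite (le_lt_trans (metric_triangle _ w2 _))// -ltrBrDr metric_sym.
exact: w32.
Qed.

(** Since [t] may be smaller than [T], the arc of [u] cannot be a segment of its own: it is appended
    to the last segment of the chain. *)
Lemma extend_end p q u t : chains_between S p q -> adm u -> 0 <= t ->
  chains_between S p (psi S t q u).
Proof.
move=> /chains_betweenP pq uad t0; apply/chains_betweenP => e T e0 T0.
have [delta d0 hd] := near_phi_flow t q.1 q.2 uad e0.
have m0 : 0 < Num.min e delta by rewrite lt_min e0.
have [w pw wq] := pq _ T m0 T0.
have me : Num.min e delta <= e by rewrite ge_min lexx.
have md : Num.min e delta <= delta by rewrite ge_min lexx orbT.
have [[w1 x1] [pp1 [v [s [vad /andP[Ts _] /= sw xq]]]]] := reach_last pw.
have s0 : 0 <= s by rewrite (le_trans (ltW T0)).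
pose c := concat_control s v u.
have cad : adm c by exact: adm_concat.
have cE : phi S (t + s) w1 x1 c = phi S t w (phi S s w1 x1 v) u.
  have [_ h] := phi_concat w1 x1 vad uad s0.
  by rewrite h ?lerDr// addrK sw.
have wd : mdist q.1 w < delta by rewrite metric_sym (lt_le_trans wq).
have xd : mdist q.2 (phi S s w1 x1 v) < delta.
  by rewrite metric_sym (lt_le_trans xq).
have [f1 f2] := hd _ _ wd xd.
exists (flow S t w); last by rewrite metric_sym.
have last : reach e T (w1, x1) (flow S t w, phi S t q.1 q.2 u).
  rewrite -sw -flowD; apply: (reach_long T0 cad).
    by rewrite (le_trans Ts)// lerDr.
  by rewrite cE metric_sym.
case: pp1 => [->//|pp1].
by apply: reach_trans last; exact: reach_weaken pp1.
Qed.

Lemma extend_start q r u t : chains_between S q r -> adm u -> t <= 0 ->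
  chains_between S (psi S t q u) r.
Proof.
move=> /chains_betweenP qr uad t0; apply/chains_betweenP => e T e0 T0.
have [w qw wr] := qr e T e0 T0; exists w => //.
have [[w1 x1] [[v [s [vad /andP[Ts _] /= sw xq]]] qw1]] := reach_first qw.
have utad := admS t uad.
have Nt0 : 0 <= - t by rewrite oppr_ge0.
pose c := concat_control (- t) (fun a => u (a + t)) v.
have cad : adm c by exact: adm_concat.
have qE : phi S (- t) (flow S t q.1) (phi S t q.1 q.2 u) (fun a => u (a + t)) = q.2.
  by rewrite -phi_add// addNr phi0.
have cE : phi S (s - t) (flow S t q.1) (phi S t q.1 q.2 u) c = phi S s q.1 q.2 v.
  have [_ h] := phi_concat (flow S t q.1) (phi S t q.1 q.2 u) utad vad Nt0.
  by rewrite h ?lerDr ?(le_trans (ltW T0))// addrK qE -flowD addNr flow0.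
have first : reach e T (psi S t q u) (w1, x1).
  rewrite -sw (_ : flow S s q.1 = flow S (s - t) (flow S t q.1)); last first.
    by rewrite -flowD subrK.
  by apply: (reach_long T0 cad); rewrite ?cE// (le_trans Ts)// lerDl.
by case: qw1 => [<-//|qw1]; exact: reach_trans first qw1.
Qed.

(* A chain may be entered at a point close to one of its segments, at the price
   of one extra jump after time [T]. *)
Lemma reach_tail w (z z' y : M) v (e T delta L : R) : 0 < T -> 0 < e ->
  (forall (q : M) u s, mdist z q < delta -> adm u -> 0 <= s <= 2 * T ->
     mdist (phi S s w z u) (phi S s w q u) < e / 2) ->
  mdist z z' < delta -> adm v -> T <= L -> mdist (phi S L w z' v) y < e / 2 ->
  reach e T (w, z) (flow S L w, y).
Proof.
move=> T0 e0 close zz' vad TL z'y.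
(* [close] covers times up to [2 * T] only, whereas [L] is unbounded: beyond that, the jump at time
   [T] moves onto the trajectory of [z']. *)
have [L2|/ltW L2] := leP L (2 * T).
  apply: (reach_long T0 vad TL).
  rewrite (le_lt_trans (metric_triangle _ (phi S L w z' v) _))//.
  rewrite [ltRHS]splitr ltrD// close//.
  by rewrite L2 (le_trans (ltW T0)).
have LE : L = (L - T) + T by rewrite subrK.
have T2 : T <= 2 * T by rewrite ler_peMl ?ler1n// ltW.
have e2 : e / 2 < e by rewrite ltr_pdivrMr// ltr_pMr// ltr1n.
apply: (@reach_trans _ _ _ (flow S T w, phi S T w z' v)).
  apply: (reach_long T0 vad (lexx T)).
  by rewrite (lt_trans _ e2)// close// T2 ltW.
rewrite LE flowD; apply: (reach_long T0 (admS T vad)); first by lra.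
by rewrite -phi_add// -LE (lt_trans z'y).
Qed.

(** * Trajectories joined to their starting point by chains in both directions *)

Lemma natSinv_lt (F : set_system nat) {FF : Filter F} (e : R) : \oo `<=` F ->
  0 < e -> \forall k \near F, k.+1%:R^-1 < e.
Proof. by move=> sF e0; apply: sF; exact: (near_infty_natSinv_lt (PosNum e0)). Qed.

Lemma natS_ge (F : set_system nat) {FF : Filter F} (T : R) : \oo `<=` F ->
  \forall k \near F, T <= k.+1%:R.
Proof.
move=> sF; apply: sF; near=> k; apply: (@le_trans _ _ k%:R).
  by near: k; exact: nbhs_infty_ger.
by rewrite ler_nat.
Unshelve. all: by end_near. Qed.

Lemma forward_viability p r : chains_between S p r ->
  exists2 u, adm u & forall t, 0 <= t -> chains_between S (psi S t p u) r.
Proof.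
move=> /chains_betweenP pr.
(* Components of [z]: the control and the length of the first segment, the point it jumps to, and
   the exact last base point of the chain. *)
have /choice[f fP] (k : nat) : exists z : (R -> 'rV[R]_m) * (R * (M * Omega)),
    [/\ adm z.1, k.+1%:R <= z.2.1,
      mdist (phi S z.2.1 p.1 p.2 z.1) z.2.2.1 < k.+1%:R^-1,
      (flow S z.2.1 p.1, z.2.2.1) = (z.2.2.2, r.2) \/
        reach k.+1%:R^-1 k.+1%:R (flow S z.2.1 p.1, z.2.2.1) (z.2.2.2, r.2) &
      mdist z.2.2.2 r.1 < k.+1%:R^-1].
  have k0 : 0 < k.+1%:R^-1 :> R by rewrite invr_gt0.
  have [w pw wr] := pr k.+1%:R^-1 k.+1%:R k0 (ltr0Sn _ _).
  have [[w1 x1] [[v [s [vad /andP[Ts _] /= sw xq]]] qw1]] := reach_first pw.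
  by exists (v, (s, (x1, w))) => /=; rewrite sw.
have [F [UF sF]] := ultraFilterLemma (eventually_filter : ProperFilter \oo).
have PF : ProperFilter F by exact: ultra_proper.
have fad k : adm (f k).1 by have [] := fP k.
have cU : compact (Urange S) by exact: Urange_cpt.
have vU : convex_set (Urange S) by exact: Urange_convex.
have [u uad weak] := weak_compactness (F := F) cU vU fad.
exists u => // t t0; apply/chains_betweenP => e T e0 T0.
have T20 : 0 <= 2 * T by rewrite mulr_ge0// ltW.
have e20 : 0 < e / 2 by rewrite divr_gt0.
have e2e : e / 2 < e by rewrite ltr_pdivrMr// ltr_pMr// ltr1n.
(* Chosen before [k]: the control followed after time [t] is a shift of [(f k).1], so [delta] must
   be uniform in the control. *)
have [delta d0 close] :=
  phi_equicontinuous S (flow S t p.1) (phi S t p.1 p.2 u) T20 e20.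
have ct : phi S t p.1 p.2 (f k).1 @[k --> F] --> phi S t p.1 p.2 u.
  apply: (phi_weak_convergence_pt fad uad _ weak); exact: cvg_cst.
have n1 := metricType_numDomainType.cvgr_dist_lt ct d0.
have [k [[h1 h2] h3]] := filter_ex (filterI (filterI (n1 _)
  (natSinv_lt sF e20)) (natS_ge (t + T) sF)).
have [vad ks kx kr kw] := fP k.
set v := (f k).1 in h1 vad kx kr; set s := (f k).2.1 in ks kx kr.
set x1 := (f k).2.2.1 in kx kr; set w := (f k).2.2.2 in kr kw.
exists w; last by rewrite (lt_trans kw)// (lt_trans h2).
have sE : s = (s - t) + t by rewrite subrK.
have first : reach e T (psi S t p u) (flow S s p.1, x1).
  rewrite /psi sE flowD.
  apply: (reach_tail T0 e0 close h1 (admS t vad)).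
    by rewrite lerBrDr addrC (le_trans h3).
  by rewrite -phi_add// -sE (lt_trans kx).
case: kr => [<-//|kr]; apply: reach_trans first _.
apply: reach_weaken kr => //; last by rewrite ltW// (lt_trans h2).
by rewrite (le_trans _ h3)// lerDr.
Qed.

Lemma backward_viability p r : chains_between S r p ->
  exists2 u, adm u & forall t, t <= 0 -> chains_between S r (psi S t p u).
Proof.
move=> /chains_betweenP rp.
(* Components of [z]: the control and the length of the last segment, and the point and base from
   which it starts. *)
have /choice[f fP] (k : nat) : exists z : (R -> 'rV[R]_m) * (R * (M * Omega)),
    [/\ adm z.1, k.+1%:R <= z.2.1,
      mdist p.2 (phi S z.2.1 z.2.2.2 z.2.2.1 z.1) < k.+1%:R^-1,
      r = (z.2.2.2, z.2.2.1) \/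
        reach k.+1%:R^-1 k.+1%:R r (z.2.2.2, z.2.2.1) &
      mdist p.1 (flow S z.2.1 z.2.2.2) < k.+1%:R^-1].
  have k0 : 0 < k.+1%:R^-1 :> R by rewrite invr_gt0.
  have [w rw wp] := rp k.+1%:R^-1 k.+1%:R k0 (ltr0Sn _ _).
  have [[w1 x1] [rw1 [v [s [vad /andP[Ts _] /= sw xq]]]]] := reach_last rw.
  by exists (v, (s, (x1, w1))) => /=; rewrite sw metric_sym (metric_sym p.1).
have [F [UF sF]] := ultraFilterLemma (eventually_filter : ProperFilter \oo).
have PF : ProperFilter F by exact: ultra_proper.
(* The shift places the end of the last segment at time 0; these ends [(W k, Z k)] tend to [p]. *)
pose v k (a : R) := (f k).1 (a + (f k).2.1).
have vad k : adm (v k) by apply: admS; have [] := fP k.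
pose W k := flow S (f k).2.1 (f k).2.2.2.
pose Z k := phi S (f k).2.1 (f k).2.2.2 (f k).2.2.1 (f k).1.
have cvgW : W k @[k --> F] --> p.1.
  apply/metricType_numDomainType.cvgrPdist_lt => e e0.
  apply: filterS (natSinv_lt sF e0) => k; apply: lt_trans.
  by have [] := fP k.
have cvgZ : Z k @[k --> F] --> p.2.
  apply/metricType_numDomainType.cvgrPdist_lt => e e0.
  apply: filterS (natSinv_lt sF e0) => k; apply: lt_trans.
  by have [] := fP k.
have cU : compact (Urange S) by exact: Urange_cpt.
have vU : convex_set (Urange S) by exact: Urange_convex.
have [u uad weak] := weak_compactness (F := F) cU vU vad.
exists u => // t t0; apply/chains_betweenP => e T e0 T0.
have ct : phi S t (W k) (Z k) (v k) @[k --> F] --> phi S t p.1 p.2 u.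
  by apply: (phi_weak_convergence_pt vad uad cvgW weak cvgZ); exact: cvg_cst.
have cw : flow S t (W k) @[k --> F] --> flow S t p.1.
  by apply: cvg_flow => //; exact: cvg_cst.
have n1 := metricType_numDomainType.cvgr_dist_lt ct e0.
have n2 := metricType_numDomainType.cvgr_dist_lt cw e0.
have [k [[h1 h2] [h3 h4]]] := filter_ex (filterI (filterI (n1 _) (n2 _))
  (filterI (natSinv_lt sF e0) (natS_ge (T - t) sF))).
have [fad ks _ kr _] := fP k.
exists (flow S t (W k)); last by rewrite metric_sym.
(* The last segment is stopped [- t] before its end; since its length is at least [T - t], at least
   [T] remains. *)
have last : reach e T ((f k).2.2.2, (f k).2.2.1) (flow S t (W k), (psi S t p u).2).
  rewrite /W -flowD; apply: (reach_long T0 fad).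
    by have := le_trans h4 ks; lra.
  by rewrite phi_add// metric_sym.
case: kr => [->//|kr]; apply: reach_trans last.
apply: reach_weaken kr => //; last exact: ltW.
by rewrite (le_trans _ h4)// lerDl oppr_ge0.
Qed.

(** For [t >= 0] reaching the trajectory is immediate and the return is the limit argument; for
    [t <= 0] the roles are exchanged. The two controls are therefore chosen independently and joined
    at time 0. *)
Lemma chains_between_viable p : chains_between S p p ->
  exists2 u, adm u & forall t,
    chains_between S p (psi S t p u) /\ chains_between S (psi S t p u) p.
Proof.
move=> pp.
have [u uad fu] := forward_viability pp.
have [v vad bv] := backward_viability pp.
pose c := concat_control 0 v u.
exists c; first exact: adm_concat.
have [cv cu] := phi_concat p.1 p.2 vad uad (lexx 0).
move=> t; have [t0|/ltW t0] := leP 0 t.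
  have -> : psi S t p c = psi S t p u.
    by rewrite /psi cu// subr0 flow0 phi0.
  by split; [exact: extend_end|exact: fu].
have -> : psi S t p c = psi S t p v by rewrite /psi cv.
by split; [exact: bv|exact: extend_start].
Qed.

Lemma maximal_chain_controllable_viable (A : set (Omega * M)) :
  maximal_chain_controllable S A -> viable_chain_transitive S A.
Proof.
move=> [[A0 Acc] Amax]; split => // p Ap.
have [u uad up] := chains_between_viable (Acc p p Ap Ap).
exists u => // t; have [pq qp] := up t.
set q := psi S t p u in pq qp *.
have <- : A `|` [set q] = A; last by right.
apply: Amax; last by move=> z; left.
split; first by exists p; left.
(* Any two points of the enlarged set, including [q] with itself, are joined through [p]. *)
have to_p a : (A `|` [set q]) a -> chains_between S a p.
  by case=> [Aa|->//]; exact: Acc.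
have of_p a : (A `|` [set q]) a -> chains_between S p a.
  by case=> [Aa|->//]; exact: Acc.
by move=> a b /to_p ap /of_p pb; exact: chains_between_trans ap pb.
Qed.

(** Any larger candidate for a chain control set is in particular chain controllable, so maximality
    carries over. *)
Lemma maximal_chain_control_set (A : set (Omega * M)) :
  maximal_chain_controllable S A -> chain_control_set S A.
Proof.
move=> Amax; have [A0 Acc] := Amax.1.
split => //; first exact: maximal_chain_controllable_viable.
move=> B [_ Bcc] AB; apply: Amax.2 => //; split => //.
by case: A0 => a Aa; exists a; exact: AB.
Qed.

(** The chain is stopped on its segment [i]: [tau] is itself an admissible jump time, and the jump
    goes to [z]. *)
Lemma chain_hull_entry w0 (Fw0 : set M) z : chain_hull S w0 Fw0 z ->
  exists2 x0, Fw0 x0 & chains_between S (w0, x0) z.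
Proof.
move=> [x0 [y0 [Fx [Fy H]]]]; exists x0 => //.
apply/chains_betweenP => e T e0 T0.
have [n [ws [xs [us [Ts [C [i [tau [in_ tauT zE zd]]]]]]]]] := H e T e0 T0.
exists z.1; last by rewrite mdistxx.
have last : reach e T (ws i, xs i) (z.1, z.2).
  apply: reach_step; exists (us i), tau; split => //=.
    exact: (chain_controls C).
  by rewrite metric_sym.
have T3 : T <= 3 * T by rewrite ler_peMl ?ler1n// ltW.
(* For [i = 0] the stopped segment is the whole chain. *)
rewrite -(chain_start C); have [i0|i0] := posnP i; first by move: last; rewrite i0.
apply: reach_trans last; apply: (chain_reach C) => //.
by rewrite i0 ltnW.
Qed.

(** The chain is entered at [z], close to its segment [i], whose remaining length is at least
    [3 * T - 2 * T = T]. *)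
Lemma chain_hull_exit w0 (Fw0 : set M) z : chain_hull S w0 Fw0 z ->
  exists2 y0, Fw0 y0 & chains_between S z (w0, y0).
Proof.
move=> [x0 [y0 [Fx [Fy H]]]]; exists y0 => //.
apply/chains_betweenP => e T e0 T0.
have T20 : 0 <= 2 * T by rewrite mulr_ge0// ltW.
have e20 : 0 < e / 2 by rewrite divr_gt0.
have e2e : e / 2 < e by rewrite ltr_pdivrMr// ltr_pMr// ltr1n.
have [delta d0 close] := phi_equicontinuous S z.1 z.2 T20 e20.
(* The chain comes within [delta] of [z], as entering it requires, and its jumps are below [e / 2],
   which leaves room for the entry error. *)
have m0 : 0 < Num.min delta (e / 2) by rewrite lt_min d0.
have md : Num.min delta (e / 2) <= delta by rewrite ge_min lexx.
have me : Num.min delta (e / 2) <= e / 2 by rewrite ge_min lexx orbT.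
have [n [ws [xs [us [Ts [C [i [tau [in_ tauT zE zd]]]]]]]]] := H _ T m0 T0.
exists (ws n); last first.
  by rewrite (lt_trans _ e2e)// (lt_le_trans (chain_base_end C)).
have uad := chain_controls C in_.
have /andP[Ts3 _] := chain_times C in_.
have /andP[tau1 tau2] := tauT.
have LE : Ts i = (Ts i - tau) + tau by rewrite subrK.
have first : reach e T z (ws i.+1, xs i.+1).
  have base : ws i.+1 = flow S (Ts i - tau) z.1.
    by rewrite zE -flowD subrK (chain_base C).
  rewrite base [z]surjective_pairing /=.
  apply: (reach_tail T0 e0 close (lt_le_trans zd md) (admS tau uad)).
    by lra.
  rewrite zE -phi_add// -LE; apply: lt_le_trans me.
  exact: (chain_jumps C).
have T3 : T <= 3 * T by rewrite ler_peMl ?ler1n// ltW.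
have xn : xs n = y0 := chain_end C.
(* If segment [i] is the last one, its remainder already ends over [y0]. *)
have [iN|iN] := ltnP i.+1 n.
  apply: reach_trans first _; rewrite /= -xn.
  apply: (@reach_weaken _ (Num.min delta (e / 2)) _ T) => //.
    by rewrite (le_trans me)// ltW.
  by apply: (chain_reach C) => //; rewrite iN leqnn.
have <- : i.+1 = n by apply/eqP; rewrite eqn_leq in_.
by move: first; rewrite -xn /=; have -> : i.+1 = n by apply/eqP; rewrite eqn_leq in_.
Qed.

End chains.

Theorem theorem16 (R : realType) (Omega M : metricType R) (d m : nat)
    (S : control_system Omega M d m) (w0 : Omega) (Fw0 : set M)
    (Fw0_nonvoid : Fw0 !=set0)
    (Fw0_chains : forall x0 y0 : M, Fw0 x0 -> Fw0 y0 ->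
       chains_between S (w0, x0) (w0, y0)) :
  (chain_hull S w0 Fw0 !=set0 -> chain_controllable S (chain_hull S w0 Fw0)) /\
  ((exists (Q : set M) (A : set (Omega * M)),
      [/\ compact Q, maximal_chain_controllable_in S Q A &
          chain_hull S w0 Fw0 `<=` A]) ->
   exists2 E : set (Omega * M),
     chain_control_set S E & chain_hull S w0 Fw0 `<=` E).
Proof.
split=> [F0|[Q [A [_ [Amax _] FA]]]]; last first.
  by exists A => //; exact: maximal_chain_control_set.
split => // p q /chain_hull_exit[y0 Fy py] /chain_hull_entry[x0 Fx xq].
apply: chains_between_trans py _; apply: chains_between_trans xq.
exact: Fw0_chains.
Qed.
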